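(* Let $n\in\{2,3\}$ and let $\lambda,\mu$ be Lamé constants with $\mu>0$, $n\lambda+2\mu>0$. There is a constant $C=C_{n,\lambda,\mu}>0$ such that the following holds. Let $\Omega\subset\mathbb R^n$ be a bounded Lipschitz domain with diameter at most $D$ ($D>0$) and connected complement, let $(\Omega;\lambda,\mu,V)$ be an inhomogeneous medium scatterer, let $\omega>0$, put $\varepsilon=d(\Omega)\,\omega$ with $d(\Omega)$ the diameter of $\Omega$, and suppose $V\in\widetilde C^\delta(\overline\Omega)$ and $\inf_{\partial\Omega}|V|>0$, where $\delta\in(0,1]$ if $n=2$ and $\delta\in(0,1/2]$ if $n=3$. Let $\mathbf w,\mathbf v\in L^2(\Omega)^n$ be a pair of transmission eigenfunctions corresponding to the transmission eigenvalue $\omega$. If $\|\mathbf w\|_{\widetilde C^\delta(\overline\Omega)^n}\le1$, then $$\sup_{\partial\Omega}|\mathbf w|\le C\,\frac{\|V\|_{\widetilde C^\delta}}{\inf_{\partial\Omega}|V|}\,\varepsilon^\delta\bigl(1+(1+\varepsilon)\varepsilon^{n/2}\bigr).$$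
   Context: $\mathcal L\mathbf u=\mu\Delta\mathbf u+(\lambda+\mu)\nabla(\nabla\cdot\mathbf u)$. $V\in L^\infty(\mathbb R^n)$ is scalar with $\mathrm{supp}(V)\subset\Omega$ (boundary values are those of the continuous extension from $\Omega$ to $\overline\Omega$). Transmission eigenvalue problem: $\omega>0$ is an elastic transmission eigenvalue and $(\mathbf w,\mathbf v)$ a corresponding pair of transmission eigenfunctions if $(\mathbf w,\mathbf v)\ne(\mathbf 0,\mathbf 0)$ (the paper's definition takes the pair in $H^1(\Omega)^n\times H^1(\Omega)^n$) and $$\mathcal L\mathbf w+\omega^2(1+V)\mathbf w=\mathbf 0,\quad \mathcal L\mathbf v+\omega^2\mathbf v=\mathbf 0\ \text{ in }\Omega,\qquad \mathbf w=\mathbf v,\quad T_\nu\mathbf w=T_\nu\mathbf v\ \text{ on }\partial\Omega,$$ with $\nu$ the unit outer normal and traction operator $T_\nu\mathbf u=2\mu\,\partial_\nu\mathbf u+\lambda\nu\,\nabla\cdot\mathbf u+\mu\nu^\perp(\partial_2u_1-\partial_1u_2)$, $\nu^\perp=(-\nu_2,\nu_1)^\top$, if $n=2$; $T_\nu\mathbf u=2\mu\,\partial_\nu\mathbf u+\lambda\nu\,\nabla\cdot\mathbf u+\mu\,\nu\times(\nabla\times\mathbf u)$ if $n=3$. Norm: $\|g\|_{\widetilde C^\delta(\overline\Omega)}=\|g\|_{L^\infty(\Omega)}+\omega^{-\delta}[g]_{\delta,\Omega}$, where $[g]_{\delta,\Omega}$ is the Hölder seminorm $\sup_{\mathbf x\neq\mathbf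 y\in\Omega}|g(\mathbf x)-g(\mathbf y)|/|\mathbf x-\mathbf y|^\delta$ (maximum over components if $g$ is vector-valued). *)

(* Defs.v *)
From HB Require Import structures.
From mathcomp Require Import all_boot all_order all_algebra.
From mathcomp Require Import all_classical all_reals all_analysis.
From mathcomp.real_closed Require Import complex.

Set Implicit Arguments.
Unset Strict Implicit.
Unset Printing Implicit Defensive.

Import Order.TTheory GRing.Theory Num.Theory.
Import numFieldNormedType.Exports.

Local Open Scope classical_set_scope.
Local Open Scope ring_scope.
Local Open Scope complex_scope.

Definition rV_display : measure_display.
Proof. exact: default_measure_display. Qed.

(* The sigma-algebra generated by the coordinates, i.e. the Borel sets. *)
Section measurable_rV.
Context {R : realType}.
Variable n : nat.

Let coords : 'I_n -> 'rV[R]_n -> measurableTypeR R := fun i x => x ord0 i.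

Let rV_set0 : g_sigma_preimage coords set0.
Proof. exact: sigma_algebra0. Qed.

Let rV_setC A : g_sigma_preimage coords A -> g_sigma_preimage coords (~` A).
Proof. exact: sigma_algebraC. Qed.

Let rV_bigcup (F : _^nat) : (forall i, g_sigma_preimage coords (F i)) ->
  g_sigma_preimage coords (\bigcup_i (F i)).
Proof. exact: sigma_algebra_bigcup. Qed.

HB.instance Definition _ := @isMeasurable.Build rV_display
    'rV[R]_n (g_sigma_preimage coords) rV_set0 rV_setC rV_bigcup.

Lemma measurable_coord (i : 'I_n) :
  measurable_fun [set: 'rV[R]_n] (fun x => x ord0 i : measurableTypeR R).
Proof.
move=> _ Y mY; rewrite setTI; apply: sub_sigma_algebra => /=.
rewrite -bigcup_seq/=; exists i => /=; first by rewrite mem_index_enum.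
by exists Y => //; rewrite setTI.
Qed.

Lemma measurable_fun_coordP d (T : measurableType d) (f : T -> 'rV[R]_n) :
  (forall i, measurable_fun [set: T] (fun t => f t ord0 i : measurableTypeR R))
  -> measurable_fun [set: T] f.
Proof.
move=> mf _ Y mY; rewrite setTI.
have : preimage_set_system [set: T] f (g_sigma_preimage coords) (f @^-1` Y).
  by exists Y => //; rewrite setTI.
rewrite -g_sigma_preimage_comp; apply: smallest_sub => [|A].
  exact: sigma_algebra_measurable.
rewrite -bigcup_seq/= => -[i _ [B mB <-]]; exact: mf.
Qed.

End measurable_rV.

Section lebesgue_rV.
Context {R : realType}.

Definition cons_rV n (p : measurableTypeR R * 'rV[R]_n) : 'rV[R]_n.+1 :=
  \row_i if unlift ord0 i is Some j then p.2 ord0 j else p.1.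

Lemma measurable_cons_rV n : measurable_fun setT (@cons_rV n).
Proof.
apply: measurable_fun_coordP => i.
case: (unliftP ord0 i) => [j|] ->.
  rewrite (_ : (fun _ => _) =
    (fun x : 'rV[R]_n => x ord0 j : measurableTypeR R) \o snd).
    exact: measurableT_comp (measurable_coord j) measurable_snd.
  by apply/funext => p /=; rewrite mxE liftK.
rewrite (_ : (fun _ => _) = fst); first exact: measurable_fst.
by apply/funext => p /=; rewrite mxE unlift_none.
Qed.


Fixpoint lebesgue_rV n : {measure set 'rV[R]_n -> \bar R} :=
  match n with
  | 0 => \d_ (0 : 'rV[R]_0)
  | m.+1 => measure_function_pushforward__canonical__measure_function_Measure
      (lebesgue_measure \x^ lebesgue_rV m)%E (@measurable_cons_rV m)
  end.

Lemma measurable_box n (A : 'I_n -> set (measurableTypeR R)) :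
  (forall i, measurable (A i)) ->
  measurable [set x : 'rV[R]_n | forall i, A i (x ord0 i)].
Proof.
move=> mA.
rewrite (_ : mkset _ = \big[setI/setT]_(i < n)
    ([set: 'rV[R]_n] `&` (fun x : 'rV[R]_n => x ord0 i) @^-1` A i)).
  by apply: bigsetI_measurable => i _; exact: (measurable_coord i).
rewrite -bigcap_seq/=; apply/seteqP; split => [x Ax i _|x Ax i]; first by split.
by have [|_] := Ax i; first by rewrite /= mem_index_enum.
Qed.

Lemma lebesgue_rV_box n (A : 'I_n -> set (measurableTypeR R)) :
  (forall i, measurable (A i)) ->
  lebesgue_rV n [set x | forall i, A i (x ord0 i)] =
  (\prod_(i < n) lebesgue_measure (A i))%E.
Proof.
elim: n A => [|n ih] A mA.
  rewrite big_ord0 /= diracE mem_set//; by case.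
rewrite big_ord_recl -ih; last by move=> i; exact: mA.
have mB := measurable_box (fun i => mA (lift ord0 i)).
rewrite -(product_measure2E _ _ (mA ord0) mB).
rewrite /= /pushforward; congr (_ _); apply/seteqP; split.
  move=> [x y] /= Axy; split => [|i] /=.
    by have := Axy ord0; rewrite mxE unlift_none.
  by have := Axy (lift ord0 i); rewrite mxE liftK.
move=> [x y] /= [Ax Ay] i; rewrite mxE.
by case: (unliftP ord0 i) => [j|] -> /=.
Qed.

End lebesgue_rV.

Section geometry.
Context {R : realType} {n : nat}.
Implicit Types (x y p e : 'rV[R]_n) (Omega : set 'rV[R]_n).

(* The library norm on ['rV[R]_n] is the sup norm. *)
Definition dotp x y : R := \sum_i x ord0 i * y ord0 i.
Definition edist x y : R := Num.sqrt (dotp (x - y) (x - y)).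

Definition ediam Omega : R :=
  sup [set d | exists x y, [/\ Omega x, Omega y & d = edist x y]].

Definition bdry Omega : set 'rV[R]_n := closure Omega `\` interior Omega.

(* Near each boundary point, [Omega] is the region above the graph of a
   Lipschitz function over the hyperplane orthogonal to a unit vector [e];
   [x - dotp x e *: e] is the projection of [x] to that hyperplane. *)
Definition lipschitz_boundary Omega := forall p, bdry Omega p ->
  exists e (phi : 'rV[R]_n -> R) (K r : R),
  [/\ dotp e e = 1,
      0 < r,
      (forall x y, `|phi x - phi y| <= K * edist x y) &
      (forall x, edist x p < r ->
         (Omega x <-> phi (x - dotp x e *: e) < dotp x e))].

Definition bounded_lipschitz_domain Omega :=
  [/\ Omega !=set0, open Omega, connected Omega, bounded_set Omega
    & lipschitz_boundary Omega].

End geometry.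

Section function_spaces.
Context {R : realType} {n : nat}.
Local Notation C := R[i].
Local Notation pt := 'rV[R]_n.
Local Notation leb := (lebesgue_rV n).
Implicit Types (Omega : set pt) (f g : pt -> C) (u : pt -> 'rV[C]_n).

Definition cabs (z : C) : R := complex.Re `|z|.
Definition vabs (z : 'rV[C]_n) : R := Num.sqrt (\sum_i cabs (z ord0 i) ^+ 2).

Definition coord u (i : 'I_n) : pt -> C := fun x => u x ord0 i.

Definition cintegral Omega f : C :=
  (\int[leb]_(x in Omega) complex.Re (f x)) +i*
  (\int[leb]_(x in Omega) complex.Im (f x)).

Definition Lp (p : \bar R) Omega f :=
  (((fun x => complex.Re (f x)) \_ Omega) \in Lfun leb p) /\
  (((fun x => complex.Im (f x)) \_ Omega) \in Lfun leb p).

Definition partial (i : 'I_n) (phi : pt -> R) : pt -> R :=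
  fun x => 'D_(delta_mx ord0 i) phi x.

Fixpoint Ck (k : nat) (phi : pt -> R) : Prop :=
  continuous phi /\
  if k is k'.+1 then
    forall i, (forall x, derivable phi x (delta_mx ord0 i)) /\
              Ck k' (partial i phi)
  else True.

Definition test_function Omega (phi : pt -> R) :=
  (forall k, Ck k phi) /\
  exists2 K : set pt, compact K /\ K `<=` Omega & forall x, ~ K x -> phi x = 0.

(* [g] is the distributional derivative of [f] in direction [i]; by linearity
   real-valued test functions are enough. *)
Definition weak_partial Omega (i : 'I_n) f g :=
  forall phi, test_function Omega phi ->
  cintegral Omega (fun x => f x * (partial i phi x)%:C) =
  - cintegral Omega (fun x => g x * (phi x)%:C).

(* [f] is in H^1(Omega), with gradient [G]. *)
Definition H1 Omega f (G : 'I_n -> pt -> C) :=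
  Lp 2%:E Omega f /\
  forall i, Lp 2%:E Omega (G i) /\ weak_partial Omega i f (G i).

(* H^1_0(Omega), the functions with zero trace, is the closure of the
   (complex-valued) test functions in H^1(Omega). *)
Definition H10 Omega f (G : 'I_n -> pt -> C) :=
  H1 Omega f G /\
  forall e : R, 0 < e -> exists phi psi : pt -> R,
  [/\ test_function Omega phi, test_function Omega psi,
      (\int[leb]_(x in Omega)
         (cabs (f x - (phi x +i* psi x)) ^+ 2)%:E < e%:E)%E &
      forall i, (\int[leb]_(x in Omega)
         (cabs (G i x - (partial i phi x +i* partial i psi x)) ^+ 2)%:E
           < e%:E)%E].

Definition L2v Omega u := forall i, Lp 2%:E Omega (coord u i).

(* The Jacobian is [Du x i j], the derivative of the component [i] in
   direction [j]. *)
Definition H1v Omega u (Du : pt -> 'M[C]_n) :=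
  forall i, H1 Omega (coord u i) (fun j x => Du x i j).

Definition H10v Omega u (Du : pt -> 'M[C]_n) :=
  forall i, H10 Omega (coord u i) (fun j x => Du x i j).

(* The value at a point of the closure of [Omega] of the continuous extension
   of [f] from [Omega]. *)
Definition boundary_value Omega f (p : pt) : C :=
  lim (complex.Re (f x) @[x --> within Omega (nbhs p)]) +i*
  lim (complex.Im (f x) @[x --> within Omega (nbhs p)]).

Definition vboundary_value Omega u (p : pt) : 'rV[C]_n :=
  \row_i boundary_value Omega (coord u i) p.

Definition holder_seminorm (delta : R) Omega f : \bar R :=
  ereal_sup [set s | exists x y, [/\ Omega x, Omega y, x != y
    & s = (cabs (f x - f y) / edist x y `^ delta)%:E]].

Definition holder_norm (omega delta : R) Omega f : \bar R :=
  ('N[leb]_+oo [EFin \o ((cabs \o f) \_ Omega)]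
   + (omega `^ (- delta))%:E * holder_seminorm delta Omega f)%E.

Definition vholder_norm (omega delta : R) Omega u : \bar R :=
  (\big[maxe/0]_(i < n) holder_norm omega delta Omega (coord u i))%E.

End function_spaces.

Section traction.
Context {R : realType}.
Local Notation C := R[i].

(* [(d_2 u_1 - d_1 u_2) nu^perp] if [n = 2] and [nu x curl u] if [n = 3], for
   [G] the Jacobian of [u]. *)
Definition rotation2 (G : 'M[C]_2) (nu : 'rV[C]_2) : 'rV[C]_2 :=
  (G 0 1 - G 1 0) *: \row_i [:: - nu 0 1; nu 0 0]`_i.

Definition cross3 (a b : 'rV[C]_3) : 'rV[C]_3 :=
  let a1 := a 0 0 in let a2 := a 0 1 in let a3 := a 0 2%:R in
  let b1 := b 0 0 in let b2 := b 0 1 in let b3 := b 0 2%:R in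
  \row_i [:: a2 * b3 - a3 * b2; a3 * b1 - a1 * b3; a1 * b2 - a2 * b1]`_i.

Definition curl3 (G : 'M[C]_3) : 'rV[C]_3 :=
  \row_i [:: G 2%:R 1 - G 1 2%:R; G 0 2%:R - G 2%:R 0; G 1 0 - G 0 1]`_i.

Definition rotation n : 'M[C]_n -> 'rV[C]_n -> 'rV[C]_n :=
  match n with
  | 2 => rotation2
  | 3 => fun G nu => cross3 nu (curl3 G)
  | _ => fun _ _ => 0
  end.

Definition traction n (lam mu : R) (G : 'M[C]_n) (nu : 'rV[C]_n) : 'rV[C]_n :=
  (2 * mu)%:C *: (nu *m G^T) + (lam%:C * \tr G) *: nu
  + mu%:C *: rotation G nu.

End traction.

Section lame.
Context {R : realType} {n : nat}.
Local Notation C := R[i].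
Local Notation pt := 'rV[R]_n.
Variables (lam mu : R) (Omega : set pt).
Implicit Types (u w v f : pt -> 'rV[C]_n) (V : pt -> C).

(* The component [i] of L phi, for a smooth real field [phi]. *)
Definition lame (phi : 'I_n -> pt -> R) (i : 'I_n) (x : pt) : R :=
  mu * \sum_j partial j (partial j (phi i)) x
  + (lam + mu) * partial i (fun y => \sum_j partial j (phi j) y) x.

(* L u = f in the sense of distributions; L is formally self-adjoint. *)
Definition lame_eq u f :=
  forall phi : 'I_n -> pt -> R, (forall i, test_function Omega (phi i)) ->
  cintegral Omega (fun x => \sum_i u x ord0 i * (lame phi i x)%:C) =
  cintegral Omega (fun x => \sum_i f x ord0 i * (phi i x)%:C).

(* For [u] with Jacobian [Du] and L u = [f], this is the duality pairing of the
   boundary traction T_nu u with the trace of [Phi].  Since T_nu u is linear in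
   nu and the sum over j of d_j (T_(e_j) u) is L u, the divergence theorem
   gives, for smooth [u], that the integral over the boundary of T_nu u . Phi is
   the integral over Omega of the sum over j of T_(e_j) u . d_j Phi, plus
   L u . Phi. *)
Definition traction_pairing (Du : pt -> 'M[C]_n) f
    (Phi : pt -> 'rV[C]_n) (DPhi : pt -> 'M[C]_n) : C :=
  cintegral Omega (fun x =>
    \sum_j \sum_i traction lam mu (Du x) (delta_mx ord0 j) ord0 i * DPhi x i j
    + \sum_i f x ord0 i * Phi x ord0 i).

Definition zero_traction (Du : pt -> 'M[C]_n) f :=
  forall Phi DPhi, H1v Omega Phi DPhi -> traction_pairing Du f Phi DPhi = 0.

(* The boundary conditions are those of w - v: zero trace and zero traction.
   For [w] and [v] in H^1 this is, by linearity, equality of the traces and of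
   the tractions; in this form it also makes sense when [w] and [v] are only
   square-integrable. *)
Definition transmission_eigenfunctions V (omega : R) w v :=
  let w_source x := - (omega ^+ 2)%:C *: ((1 + V x) *: w x) in
  let v_source x := - (omega ^+ 2)%:C *: v x in
  [/\ L2v Omega w /\ L2v Omega v,
      ~ {ae lebesgue_rV n, forall x, Omega x -> w x = 0 /\ v x = 0},
      lame_eq w w_source,
      lame_eq v v_source &
      exists2 Du, H10v Omega (fun x => w x - v x) Du
                & zero_traction Du (fun x => w_source x - v_source x)].

(* The support condition is supp V in the closure of Omega, as V need not
   vanish on the boundary. *)
Definition inhomogeneous_medium_scatterer V :=
  [/\ bounded_lipschitz_domain Omega,
      connected (~` Omega),
      0 < mu /\ 0 < n%:R * lam + 2 * mu,
      Lp +oo%E setT V &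
      closure [set x | V x != 0] `<=` closure Omega].

End lame.

(* Main.v *)
(* The difference u = w - v has zero Cauchy data and L u + omega^2 u =
   - omega^2 V w, so V w is orthogonal on Omega to every solution Phi of
   L Phi + omega^2 Phi = 0. Take for Phi the real shear wave
   cos (k (x_j - y_j)) e_i with j <> i and mu k^2 = omega^2, where y is a point
   of Omega. If eps is small, the cosine exceeds 1/2 on Omega, whereas V w
   varies on Omega by at most 2 ||V|| eps^delta; a real or imaginary part of
   V w_i that is larger than this at y would keep its sign on Omega, against
   the orthogonality. Hence |V w_i| <= 4 ||V|| eps^delta on Omega, and, in the
   limit, on the boundary. If eps is not small, |w_i| <= 1 and
   inf |V| <= ||V|| are enough. *)

From HB Require Import structures.
Require Import Defs.
From mathcomp Require Import all_boot all_order all_algebra.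
From mathcomp Require Import all_classical all_reals all_analysis.
From mathcomp.real_closed Require Import complex.
From mathcomp Require Import measurable_realfun ess_sup_inf.
From mathcomp Require Import ring lra.

Import Order.TTheory GRing.Theory Num.Theory.
Import numFieldNormedType.Exports.

Local Open Scope classical_set_scope.
Local Open Scope ring_scope.

Set Implicit Arguments.
Unset Strict Implicit.
Unset Printing Implicit Defensive.

(** * Borel sets and Lebesgue measure on row vectors *)

(** The wave [cos (k (x_j - y_j)) e_i] with [i != j] is divergence free and its Jacobian has the
    single entry [(i, j)]; it therefore meets only an off-diagonal traction of [u], from which [lam]
    is absent. Tested with a field that need not vanish on the boundary, the zero-traction condition
    is the weak equation for [u] up to the boundary, and one integration by parts moves the
    derivative of [u] to the wave. No boundary integral appears, since [u] is in the closure of the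
    test functions: for these the identity follows from Fubini and the fundamental theorem of
    calculus, and it survives the limit because the wave is bounded and Omega has finite measure.
    The second obstacle is that the norm contains an essential supremum, while the argument is
    pointwise; Hölder continuity bridges the two. *)

Section borel_rV.
Context {R : realType}.

Lemma cvg_rV (T : Type) (F : set_system T) {FF : Filter F} n
    (f : T -> 'rV[R]_n) (l : 'rV[R]_n) :
  (forall i, f x ord0 i @[x --> F] --> l ord0 i) -> f @ F --> l.
Proof.
move=> fl A [P nP PA]; rewrite /= /nbhs /=.
have H : \forall x \near F, forall i, P ord0 i (f x ord0 i).
  by apply: filter_forall => i; exact: (fl i).
by apply: filterS H => x Px; apply: PA => i j; rewrite ord1.
Qed.

Lemma continuous_cons_rVl n (y : 'rV[R]_n) :
  continuous (fun t : R => cons_rV (t, y)).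
Proof.
move=> t; apply: (@cvg_rV _ (nbhs t)) => i; rewrite mxE; under eq_fun do rewrite mxE.
case: (unlift ord0 i) => [j|]/=; first exact: cvg_cst.
exact: cvg_id.
Qed.

Lemma continuous_cons_rVr n (t : R) :
  continuous (fun y : 'rV[R]_n => cons_rV (t, y)).
Proof.
move=> y; apply: (@cvg_rV _ (nbhs y)) => i; rewrite mxE; under eq_fun do rewrite mxE.
case: (unlift ord0 i) => [j|]/=; last exact: cvg_cst.
exact: coord_continuous.
Qed.

(** Balls of the sup norm are boxes, which makes their measurability and their measure accessible
    through [measurable_box] and [lebesgue_rV_box]. *)
Lemma ball_rVE n (q : 'rV[R]_n) (e : R) : 0 < e ->
  ball q e = [set x | forall i, ball (q ord0 i) e (x ord0 i)].
Proof.
move=> e0; apply/seteqP; split=> [x [_ qx] i|x qx]; first exact: qx.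
by split=> // i j; rewrite ord1; exact: qx.
Qed.

Lemma measurable_ball_rV n (q : 'rV[R]_n) (e : R) : 0 < e ->
  measurable (ball q e : set 'rV[R]_n).
Proof.
move=> e0; rewrite ball_rVE//.
apply: (measurable_box (A := fun i => ball (q ord0 i) e)) => i.
by rewrite ball_itv; exact: measurable_itv.
Qed.

(* Balls of rational centre and of radius 1/k form a countable base. *)
Lemma measurable_open_rV n (U : set 'rV[R]_n) : open U -> measurable U.
Proof.
move=> oU.
pose B (q : 'rV[rat]_n * nat) : set 'rV[R]_n :=
  ball (map_mx ratr q.1 : 'rV[R]_n) q.2.+1%:R^-1.
have e0 k : 0 < k.+1%:R^-1 :> R by rewrite invr_gt0 ltr0n.
have -> : U = \bigcup_(q in [set q | B q `<=` U]) B q.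
  apply/seteqP; split=> [x Ux|x [q qU]]; last exact: qU.
  have /nbhs_ballP[e /= epos xU] := open_nbhs_nbhs (conj oU Ux).
  have [k ke] : exists k : nat, k.+1%:R^-1 < e / 2.
    have /ltr_add_invr[k] : 0 < e / 2 by rewrite divr_gt0.
    by rewrite add0r => ?; exists k.
  have H i : exists q : rat, ball (x ord0 i) k.+1%:R^-1 (ratr q : R).
    have B0 : ball (x ord0 i) k.+1%:R^-1 !=set0.
      by exists (x ord0 i); exact: ballxx.
    have [z [xz [q _ qz]]] := dense_rat B0 (ball_open _ _).
    by exists q; rewrite qz.
  have [q xq] := choice H.
  have xB : B (\row_i q i, k) x.
    rewrite /B ball_rVE//= => i; rewrite !mxE.
    exact: ball_sym.
  exists (\row_i q i, k) => //= y By; apply: xU.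
  apply: (@le_ball _ _ _ (k.+1%:R^-1 + k.+1%:R^-1)).
    by rewrite [leRHS]splitr lerD// ltW.
  by apply: ball_triangle By; exact: ball_sym.
(* The index type is countable but not [nat]: reindex by codes, with the empty set where a code
   gives no admissible ball. *)
rewrite bigcup_mkcond (_ : \bigcup_q _ = \bigcup_k
    if unpickle k is Some q then if q \in [set q | B q `<=` U] then B q else set0
    else set0).
  apply: bigcup_measurable => k _; case: unpickle => [q|//].
  by case: ifP => // _; exact: measurable_ball_rV.
apply/seteqP; split=> [x [q _ qx]|x [k _]].
  by exists (pickle q) => //; rewrite pickleK.
by case: unpickle => // q qx; exists q.
Qed.

Lemma continuous_measurable_rV n (f : 'rV[R]_n -> R) :
  continuous f -> measurable_fun setT f.
Proof.
move=> /continuousP cf; apply: (measurability _ (RGenOpens.measurableE R)) => //.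
move=> _ [_ [a [b -> <-]]]; rewrite setTI.
by apply: measurable_open_rV; apply: cf; exact: interval_open.
Qed.

Lemma continuous_measurable_within_rV n (D : set 'rV[R]_n) (f : 'rV[R]_n -> R) :
  open D -> {in D, continuous f} -> measurable_fun D f.
Proof.
move=> oD cf; apply: (measurability _ (RGenOpens.measurableE R)) => //.
move=> _ [_ [a [b -> <-]]]; apply: measurable_open_rV.
by apply/(continuous_inP _ oD).1 => //; exact: interval_open.
Qed.

End borel_rV.

Section lebesgue_rV_bounded.
Context {R : realType}.
Variable n : nat.
Implicit Types (A : set 'rV[R]_n) (B e : R).

Definition cube B : set 'rV[R]_n :=
  [set x | forall i, (`[- B, B]%classic : set R) (x ord0 i)].

Lemma measurable_cube B : measurable (cube B).
Proof.
by apply: (measurable_box (A := fun=> `[- B, B]%classic)) => i.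
Qed.

Lemma lebesgue_rV_cube_lty B : (lebesgue_rV n (cube B) < +oo)%E.
Proof.
rewrite (lebesgue_rV_box (A := fun=> `[- B, B]%classic))//.
pose I : set R := `[- B, B]%classic.
suff : (0 <= \prod_(i < n) lebesgue_measure I < +oo)%E.
  by case/andP.
elim/big_ind : _ => [|x y /andP[x0 xoo] /andP[y0 yoo]|i _].
- by rewrite lee01 ltry.
- by rewrite mule_ge0//= lte_mul_pinfty// ge0_fin_numE.
- by rewrite measure_ge0/= lebesgue_measure_itv; case: ifPn => _; rewrite ltry.
Qed.

Lemma sigma_finite_lebesgue_rV : sigma_finite [set: 'rV[R]_n] (lebesgue_rV n).
Proof.
exists (fun k => cube k%:R) => [|k].
  apply/esym/seteqP; split=> // x _.
  pose M := \sum_i `|x ord0 i|.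
  exists (Num.bound M) => // i /=.
  rewrite in_itv/= -ler_norml.
  have M0 : 0 <= M by exact: sumr_ge0.
  rewrite (le_trans _ (ltW (archi_boundP M0)))//.
  by rewrite /M (bigD1 i)//= lerDl sumr_ge0.
by split; [exact: measurable_cube|exact: lebesgue_rV_cube_lty].
Qed.

Lemma bounded_sub_cube A : bounded_set A -> exists B, A `<=` cube B.
Proof.
move=> [M [_ MA]].
exists (`|M| + 1) => x Ax i /=.
rewrite in_itv/= -ler_norml.
have := MA _ (ltr_pwDr ltr01 (ler_norm M)) _ Ax.
apply: le_trans.
rewrite [leRHS]mx_normrE.
exact: (le_bigmax _ (fun ij : 'I_1 * 'I_n => `|x ij.1 ij.2|) (ord0, i)).
Qed.

Lemma lebesgue_rV_bounded_lty A : measurable A -> bounded_set A ->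
  (lebesgue_rV n A < +oo)%E.
Proof.
move=> mA /bounded_sub_cube[B AB].
apply: le_lt_trans (lebesgue_rV_cube_lty B).
by apply: le_measure => //; rewrite inE//; exact: measurable_cube.
Qed.

(** This turns essential bounds of continuous functions into pointwise ones, and makes the integral
    over Omega of a positive constant positive. *)
Lemma lebesgue_rV_open_gt0 A : open A -> A !=set0 -> (0 < lebesgue_rV n A)%E.
Proof.
move=> oA [x Ax]; have /nbhs_ballP[e /= e0 xA] := open_nbhs_nbhs (conj oA Ax).
apply: (@lt_le_trans _ _ (lebesgue_rV n (ball x e))).
  rewrite ball_rVE// (lebesgue_rV_box (A := fun i => ball (x ord0 i) e)).
    elim/big_ind : _ => [|y z y0 z0|i _]; [exact: lte01|exact: mule_gt0|].
    by rewrite lebesgue_measure_ball ?ltW// lte_fin mulrn_wgt0.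
  by move=> i; rewrite ball_itv; exact: measurable_itv.
apply: le_measure => //; rewrite inE; first exact: measurable_ball_rV.
exact: measurable_open_rV.
Qed.

End lebesgue_rV_bounded.

(* The library's Fubini theorem asks for an instance of a sigma-finite measure,
   which [lebesgue_rV n] does not carry. *)
Section sigma_finite_instance.
Context {R : realType} (n : nat).

Definition sigma_finite_lebesgue : set 'rV[R]_n -> \bar R := lebesgue_rV n.

HB.instance Definition _ := Measure.copy sigma_finite_lebesgue (lebesgue_rV n).

HB.instance Definition _ :=
  @Measure_isSigmaFinite.Build _ _ _ sigma_finite_lebesgue
    (@sigma_finite_lebesgue_rV R n).

End sigma_finite_instance.
Arguments sigma_finite_lebesgue {R} n.

Section fubini_rV.
Context {R : realType}.
Variables (n : nat) (F : 'rV[R]_n.+1 -> R).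
Hypothesis mF : measurable_fun setT F.
Hypothesis iF : (lebesgue_rV n.+1).-integrable setT (EFin \o F).

Let leb := @sigma_finite_lebesgue R n.

Let iFc2 : (lebesgue_measure \x^ leb)%E.-integrable setT
   (fun p : measurableTypeR R * 'rV[R]_n => (F (cons_rV p))%:E).
Proof.
apply/integrableP; split.
  apply/measurable_EFinP.
  exact: measurableT_comp mF (@measurable_cons_rV R n).
have /integrableP[_] := iF.
rewrite ge0_integral_pushforward//; first exact: measurable_cons_rV.
by apply: measurableT_comp => //; exact/measurable_EFinP.
Qed.

(** [lebesgue_rV] is built on [\x^], while the Fubini lemmas used below take integrability for [\x].
    The two measures agree on rectangles, hence everywhere. *)
Let iFc1 : (lebesgue_measure \x leb)%E.-integrable setT
   (fun p : measurableTypeR R * 'rV[R]_n => (F (cons_rV p))%:E).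
Proof.
have /integrableP[mFc foo] := iFc2.
apply/integrableP; split => //; move: foo; congr (_ < _)%E.
apply: eq_measure_integral => A mA _; apply/esym.
by apply: product_measure_unique => // C D mC mD/=; rewrite product_measure2E.
Qed.

Let integral_rV_prod : (\int[lebesgue_rV n.+1]_x (F x)%:E =
  \int[lebesgue_measure \x^ leb]_p (F (cons_rV p))%:E)%E.
Proof.
rewrite /= integral_pushforward//; first exact: measurable_cons_rV.
exact/measurable_EFinP.
 Qed.

(** The differentiated coordinate has to be in the inner integral: this order serves derivatives in
    the later coordinates, [integral_rVSr] the one in the first. *)
Lemma integral_rVSl : (\int[lebesgue_rV n.+1]_x (F x)%:E =
  \int[lebesgue_measure]_t \int[lebesgue_rV n]_y (F (cons_rV (t, y)))%:E)%E.
Proof. by rewrite integral_rV_prod -(integral12_prod_meas2 iFc1). Qed.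

Lemma integral_rVSr : (\int[lebesgue_rV n.+1]_x (F x)%:E =
  \int[lebesgue_rV n]_y \int[lebesgue_measure]_t (F (cons_rV (t, y)))%:E)%E.
Proof. by rewrite integral_rV_prod -(integral21_prod_meas2 iFc1). Qed.

End fubini_rV.

(** * Integration by parts *)

Section compactly_supported.
Context {R : realType}.

Lemma closed_cube n (B : R) : closed (cube B : set 'rV[R]_n).
Proof.
rewrite (_ : cube B = \bigcap_(i in [set: 'I_n])
  ((fun x : 'rV[R]_n => x ord0 i) @^-1` `[- B, B]%classic)); last first.
  by apply/seteqP; split=> [x Bx i _|x Bx i]; [exact: Bx|exact: (Bx i I)].
apply: closed_bigI => i _; apply: preimage_closed; last exact: interval_closed.
by move=> x _; exact: coord_continuous.
Qed.

Lemma bounded_cube n (B : R) : bounded_set (cube B : set 'rV[R]_n).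
Proof.
exists `|B|; split; first exact: num_real.
move=> M BM x Bx; suff : `|x| <= M by []; rewrite [leLHS]mx_normrE.
apply/bigmax_leP; split=> [|[i j] _ /=]; first by rewrite (le_trans _ (ltW BM)).
rewrite ord1; apply: le_trans (ltW BM).
by have := Bx j; rewrite /= in_itv/= -ler_norml => /le_trans; apply; exact: ler_norm.
Qed.

Lemma compact_cube n (B : R) : compact (cube B : set 'rV[R]_n).
Proof.
apply: bounded_closed_compact; [exact: bounded_cube|exact: closed_cube].
Qed.

Lemma integrable_continuous_cube n (f : 'rV[R]_n -> R) (B : R) :
  continuous f -> (forall x, ~ cube B x -> f x = 0) ->
  (lebesgue_rV n).-integrable setT (EFin \o f).
Proof.
move=> cf f0.
have mB := @measurable_cube R n B.
have -> : EFin \o f = (EFin \o f) \_ (cube B).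
  apply/funext => x; rewrite patchE; case: ifPn => // /negP xB /=.
  by rewrite f0// => Bx; apply: xB; rewrite inE.
apply/(integrable_mkcond _ mB).
apply: measurable_bounded_integrable => //.
- exact: lebesgue_rV_cube_lty.
- apply: measurable_funS (continuous_measurable_rV cf) => //.
- have /compact_bounded : compact (f @` cube B).
    apply: continuous_compact; last exact: compact_cube.
    exact: continuous_subspaceT.
  move=> [M [Mr H]]; exists M; split => // N MN y By; apply: (H _ MN).
  by exists y.
Qed.

Lemma partial_eq0 n (psi : 'rV[R]_n -> R) (m : 'I_n) (K : set 'rV[R]_n) :
  closed K -> (forall x, ~ K x -> psi x = 0) ->
  forall x, ~ K x -> partial m psi x = 0.
Proof.
move=> cK psi0 x Kx; rewrite /partial.
rewrite (@near_eq_derive _ _ _ psi (cst 0) x (delta_mx ord0 m)).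
  exact: derive_cst.
have : nbhs x (~` K).
  by apply: open_nbhs_nbhs; split => //; exact: closed_openC.
by apply: filterS => y; exact: psi0.
Qed.

(** A directional derivative depends only on the restriction to a line. This transfers derivatives
    between a function and its slices, and between [h] and [h] composed with a coordinate. *)
Lemma eq_derive_line (V W U : normedModType R) (f : V -> U) (g : W -> U) x v y w :
  (forall h, f (h *: v + x) = g (h *: w + y)) ->
  'D_v f x = 'D_w g y /\ (derivable f x v = derivable g y w).
Proof.
move=> fg; have fx : f x = g y by have := fg 0; rewrite !scale0r !add0r.
rewrite /derive /derivable.
rewrite (_ : (fun h => _) = fun h => h^-1 *: ((g \o shift y) (h *: w) - g y)) //.
by apply/funext => h /=; rewrite fg fx.
Qed.

Lemma shift_cons_rV_ord0 n (t h : R) (y : 'rV[R]_n) :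
  h *: delta_mx ord0 ord0 + cons_rV (t, y) = cons_rV (h *: 1 + t, y).
Proof.
apply/rowP => i; rewrite !mxE eqxx/=.
by case: unliftP => [j|] ->/=; rewrite ?mulr0 ?add0r.
Qed.

Lemma shift_cons_rV_lift n (t h : R) (y : 'rV[R]_n) (m : 'I_n) :
  h *: delta_mx ord0 (lift ord0 m) + cons_rV (t, y) =
  cons_rV (t, h *: delta_mx ord0 m + y).
Proof.
apply/rowP => i; rewrite !mxE eqxx/=.
case: unliftP => [j|] ->/=; last by rewrite mulr0 add0r.
by rewrite (inj_eq lift_inj) !mxE.
Qed.

Lemma integral_derive_eq0 (F f : R -> R) (B : R) :
  (forall t, derivable F t 1 /\ 'D_1 F t = f t) -> continuous f ->
  (forall t, ~~ (- B <= t <= B) -> F t = 0) ->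
  (forall t, ~~ (- B <= t <= B) -> f t = 0) ->
  (\int[lebesgue_measure]_t (f t)%:E = 0)%E.
Proof.
(* [B] may be negative; this [b] is positive and exceeds [B], so that [F] vanishes at both ends of
   [[-b, b]]. *)
move=> dF cf F0 f0; pose b : R := `|B| + 1.
have Bb : B < b by rewrite ltr_pwDr// ler_norm.
have bp : 0 < b by rewrite ltr_pwDr.
pose J : set R := `[- b, b]%classic.
transitivity (\int[lebesgue_measure]_(t in J) (f t)%:E)%E.
  rewrite [RHS]integral_mkcond; apply: eq_integral => t _.
  rewrite patchE; case: ifPn => //; rewrite notin_setE/= => tb.
  rewrite f0//; apply: contra_notN tb => /andP[t1 t2].
  by rewrite /J/= in_itv/= (le_trans t2 (ltW Bb)) (le_trans _ t1)// lerN2 ltW.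
have cF : continuous F.
  by move=> t; apply: differentiable_continuous; apply/derivable1_diffP; case: (dF t).
rewrite (continuous_FTC2 (F := F)).
- by rewrite F0 ?F0 ?subee// -?ltNge; apply/negP; lra.
- lra.
- exact: continuous_subspaceT.
- by split=> [t _||]; [case: (dF t)|exact/cvg_at_right_filter/cF
    |exact/cvg_at_left_filter/cF].
- by move=> t _; rewrite derive1E; case: (dF t).
Qed.

(** On each line in direction [m] the fundamental theorem of calculus gives 0. The induction on [n]
    freezes the first coordinate until [m] is the first one. *)
Lemma integral_partial_eq0 n (psi : 'rV[R]_n -> R) (m : 'I_n) (B : R) :
  continuous psi -> (forall x, derivable psi x (delta_mx ord0 m)) ->
  continuous (partial m psi) -> (forall x, ~ cube B x -> psi x = 0) ->
  (\int[lebesgue_rV n]_x (partial m psi x)%:E = 0)%E.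
Proof.
elim: n psi m => [|n IH] psi m; first by case: m.
move=> cpsi dpsi cdpsi psi0.
have mF : measurable_fun setT (partial m psi).
  exact: continuous_measurable_rV.
have iF := integrable_continuous_cube cdpsi (partial_eq0 m (closed_cube (B := B)) psi0).
have [j mj|m0] := unliftP ord0 m.
- rewrite (integral_rVSl mF iF); apply: integral0_eq => t _.
  pose phi y := psi (cons_rV (t, y)).
  have Dphi y : 'D_(delta_mx ord0 m) psi (cons_rV (t, y)) =
      'D_(delta_mx ord0 j) phi y /\
    derivable psi (cons_rV (t, y)) (delta_mx ord0 m) =
      derivable phi y (delta_mx ord0 j).
    by apply: eq_derive_line => h; rewrite mj shift_cons_rV_lift.
  have E y : 'D_(delta_mx ord0 j) phi y = partial m psi (cons_rV (t, y)).
    by rewrite /partial; case: (Dphi y) => ->.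
  rewrite (_ : (fun y => _) = (fun y => (partial j phi y)%:E)); last first.
    by apply/funext => y; rewrite -E.
  apply: IH.
  + move=> y; apply: continuous_comp; last exact: cpsi.
    exact: continuous_cons_rVr.
  + by move=> y; case: (Dphi y) => _ <-.
  + rewrite (_ : partial j phi = fun y => partial m psi (cons_rV (t, y))).
      move=> y; apply: continuous_comp; last exact: cdpsi.
      exact: continuous_cons_rVr.
    by apply/funext => y; rewrite -E.
  + move=> y yB; apply: psi0 => H; apply: yB => i.
    by have := H (lift ord0 i); rewrite mxE liftK.
- rewrite (integral_rVSr mF iF); apply: integral0_eq => y _.
  have out t : ~~ (- B <= t <= B) -> ~ cube B (cons_rV (t, y)).
    by move=> /negP tB /(_ ord0); rewrite mxE unlift_none/= in_itv/=.
  apply: (@integral_derive_eq0 (fun t => psi (cons_rV (t, y))) _ B).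
  + move=> t; have [D1 D2] : 'D_(delta_mx ord0 m) psi (cons_rV (t, y)) =
        'D_1 (fun s => psi (cons_rV (s, y))) t /\
      derivable psi (cons_rV (t, y)) (delta_mx ord0 m) =
        derivable (fun s => psi (cons_rV (s, y))) t 1.
      by apply: eq_derive_line => h; rewrite m0 shift_cons_rV_ord0.
    by rewrite -D2 -D1.
  + move=> t; apply: continuous_comp; last exact: cdpsi.
    exact: continuous_cons_rVl.
  + by move=> t /out; exact: psi0.
  + by move=> t /out; apply: (partial_eq0 _ (closed_cube (B := B))).
Qed.

End compactly_supported.

Section by_parts.
Context {R : realType} {n : nat}.
Local Notation leb := (lebesgue_rV n).
Implicit Types (Omega : set 'rV[R]_n) (phi : 'rV[R]_n -> R) (h dh : R -> R).

Lemma partial_comp_coord h dh (j m : 'I_n) (x : 'rV[R]_n) :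
  (forall t : R, is_derive t 1 h (dh t)) ->
  let g := fun y : 'rV[R]_n => h (y ord0 j) in
  derivable g x (delta_mx ord0 m) /\
  partial m g x = (m == j)%:R * dh (x ord0 j).
Proof.
move=> hdh g; rewrite /partial; have [mj|mj] := eqVneq m j.
  have [-> ->] : 'D_(delta_mx ord0 m) g x = 'D_1 h (x ord0 j) /\
      derivable g x (delta_mx ord0 m) = derivable h (x ord0 j) 1.
    apply: eq_derive_line => k; rewrite /g !mxE mj !eqxx /=.
    by congr (h (_ + _)).
  have [? ?] := hdh (x ord0 j); split => //.
  by rewrite mul1r.
have [-> ->] : 'D_(delta_mx ord0 m) g x =
      'D_(delta_mx ord0 m) (cst (h (x ord0 j))) x /\
    derivable g x (delta_mx ord0 m) =
      derivable (cst (h (x ord0 j))) x (delta_mx ord0 m).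
  apply: eq_derive_line => k; rewrite /g !mxE eqxx /= eq_sym (negbTE mj).
  by rewrite mulr0 add0r.
by split; [exact: derivable_cst|rewrite derive_cst mul0r].
Qed.

Lemma test_function_C1 Omega phi : test_function Omega phi ->
  [/\ continuous phi, (forall m x, derivable phi x (delta_mx ord0 m))
    & forall m, continuous (partial m phi)].
Proof.
move=> [/(_ 1%N) [cphi H] _]; split => // m; first by case: (H m).
by case: (H m) => _ [].
Qed.

(** Vanishing off Omega lets integrals over Omega be taken over the whole space; vanishing off a
    cube gives integrability. *)
Lemma test_function_support Omega phi : test_function Omega phi ->
  exists B : R,
    (forall x, ~ (Omega `&` cube B) x -> phi x = 0) /\
    (forall m x, ~ (Omega `&` cube B) x -> partial m phi x = 0).
Proof.
move=> [_ [K [cK KO] phi0]].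
have [B KB] := bounded_sub_cube (compact_bounded cK).
have clK : closed K by apply: compact_closed => //; exact: norm_hausdorff.
exists B; split.
- by move=> x xn; apply: phi0 => Kx; apply: xn; split; [exact: KO|exact: KB].
- move=> m x xn; apply: (partial_eq0 m clK phi0) => Kx; apply: xn.
  by split; [exact: KO|exact: KB].
Qed.

Lemma continuous_comp_coord h (j : 'I_n) : continuous h ->
  continuous (fun x : 'rV[R]_n => h (x ord0 j)).
Proof. by move=> ch x; apply: continuous_comp (ch _); exact: coord_continuous. Qed.

Lemma is_derive_continuous h dh : (forall t : R, is_derive t 1 h (dh t)) ->
  continuous h.
Proof.
move=> hdh t; apply: differentiable_continuous; apply/derivable1_diffP.
by case: (hdh t).
Qed.

Lemma integrable_test Omega phi (c : 'rV[R]_n -> R) : measurable Omega ->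
  test_function Omega phi -> continuous c ->
  leb.-integrable Omega (EFin \o (fun x => c x * phi x)) /\
  forall m, leb.-integrable Omega (EFin \o (fun x => c x * partial m phi x)).
Proof.
move=> mO tphi cc; have [cphi _ cdphi] := test_function_C1 tphi.
have [B [phi0 dphi0]] := test_function_support tphi.
split=> [|m]; apply: (integrableS measurableT mO) => //;
  apply: (@integrable_continuous_cube _ _ _ B).
- by move=> x; exact: (cvgM (cc x) (cphi x)).
- by move=> x xB; rewrite phi0 ?mulr0// => -[].
- by move=> x; exact: (cvgM (cc x) (cdphi m x)).
- by move=> x xB; rewrite dphi0 ?mulr0// => -[].
Qed.

Lemma Rintegral_test_by_parts Omega phi h dh (j m : 'I_n) : measurable Omega ->
  test_function Omega phi ->
  (forall t : R, is_derive t 1 h (dh t)) -> continuous dh ->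
  \int[leb]_(x in Omega) (h (x ord0 j) * partial m phi x) =
  - \int[leb]_(x in Omega) ((m == j)%:R * dh (x ord0 j) * phi x).
Proof.
move=> mO tphi hdh cdh; have [cphi dphi cdphi] := test_function_C1 tphi.
have ch := is_derive_continuous hdh.
have [B [phi0 dphi0]] := test_function_support tphi.
have cg := @continuous_comp_coord h j ch.
have cdg : continuous (fun x : 'rV[R]_n => (m == j)%:R * dh (x ord0 j)).
  apply: (@continuous_comp_coord (fun t => (m == j)%:R * dh t)) => t.
  exact: (cvgM (cvg_cst _) (cdh t)).
have [_ i1] := integrable_test mO tphi cg.
have [i2 _] := integrable_test mO tphi cdg.
apply/eqP; rewrite -subr_eq0 opprK -RintegralD//; apply/eqP.
(* By the product rule the two integrals add up to that of a derivative of this compactly supported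
   product. *)
pose psi := (fun x : 'rV[R]_n => h (x ord0 j)) * phi.
have pE x : partial m psi x =
    h (x ord0 j) * partial m phi x + (m == j)%:R * dh (x ord0 j) * phi x.
  have [dg gE] := @partial_comp_coord h dh j m x hdh.
  rewrite [LHS](deriveM dg (dphi m x)); congr (_ + _).
  by rewrite -[X in _ *: X]/(partial m _ x) gE [LHS]mulrC.
rewrite Rintegral_mkcond.
rewrite (_ : _ \_ _ = partial m psi); last first.
  apply/funext => x; rewrite patchE pE; case: ifPn => //; rewrite notin_setE => xO.
  by rewrite phi0 ?dphi0 ?mulr0 ?addr0// => -[].
rewrite /Rintegral (@integral_partial_eq0 _ _ _ m B)//.
- by move=> x; exact: (cvgM (cg x) (cphi x)).
- by move=> x; apply: derivableM => //; case: (@partial_comp_coord h dh j m x hdh).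
- rewrite (_ : partial m psi = fun x => h (x ord0 j) * partial m phi x +
      (m == j)%:R * dh (x ord0 j) * phi x); last exact/funext.
  move=> x; exact: (cvgD (cvgM (cg x) (cdphi m x)) (cvgM (cdg x) (cphi x))).
- move=> x xB; have -> : psi x = h (x ord0 j) * phi x by [].
  by rewrite phi0 ?mulr0// => -[].
Qed.

End by_parts.

Section square_integrable.
Context d (T : measurableType d) {R : realType} (mu : {measure set T -> \bar R}).
Implicit Types (D : set T) (c g : T -> R).

Lemma integrable_bounded D g (M : R) : measurable D -> (mu D < +oo)%E ->
  measurable_fun D g -> (forall x, D x -> `|g x| <= M) ->
  mu.-integrable D (EFin \o g).
Proof.
move=> mD Doo mg gM; apply: measurable_bounded_integrable => //.
exists M; split; first exact: num_real.
by move=> N MN x Dx; exact: le_trans (gM x Dx) (ltW MN).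
Qed.

(** Because [|c| <= 1 + c^2] and constants are integrable on [D]. *)
Lemma integrable_sqr D c : measurable D -> (mu D < +oo)%E ->
  measurable_fun D c -> mu.-integrable D (EFin \o (fun x => c x ^+ 2)) ->
  mu.-integrable D (EFin \o c).
Proof.
move=> mD Doo mc ic2.
have i1 : mu.-integrable D (EFin \o (fun x => 1 + c x ^+ 2)).
  have i0 : mu.-integrable D (EFin \o (fun=> 1 : R)).
    exact: (@integrable_bounded _ _ `|1|).
  exact: (integrableD mD i0 ic2).
apply: le_integrable i1 => //; first exact/measurable_EFinP.
move=> x _ /=; rewrite lee_fin [leRHS]ger0_norm ?addr_ge0 ?sqr_ge0//.
have := sqr_ge0 (`|c x| - 1); have := sqr_ge0 (c x).
rewrite -(real_normK (num_real (c x))).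
nra.
Qed.

Lemma integrable_boundedM D c g (M : R) : measurable D ->
  mu.-integrable D (EFin \o c) -> measurable_fun D g ->
  (forall x, D x -> `|g x| <= M) ->
  mu.-integrable D (EFin \o (fun x => c x * g x)).
Proof.
move=> mD ic mg gM.
have iM : mu.-integrable D (EFin \o (fun x => M * c x)).
  by apply: (integrableZl mD M ic).
apply: le_integrable iM => //.
  apply/measurable_EFinP; apply: measurable_funM => //.
  exact/measurable_EFinP/(measurable_int mu).
move=> x Dx /=; rewrite lee_fin !normrM [leRHS]mulrC ler_wpM2l//.
by rewrite (le_trans (gM x Dx))// ler_norm.
Qed.

Lemma Lfun2_restrict D c : measurable D -> (mu D < +oo)%E ->
  (c \_ D) \in Lfun mu 2 ->
  measurable_fun D c /\ mu.-integrable D (EFin \o c).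
Proof.
move=> mD Doo cL.
have mc : measurable_fun D c.
  by apply/(measurable_restrictT c mD); move/sub_Lfun_mfun : cL; rewrite inE.
split => //; apply: integrable_sqr => //.
have := integrableS measurableT mD (@subsetT _ _) (Lfun2_integrable_sqr cL).
apply: eq_integrable => // x Dx /=; by rewrite patchE Dx.
Qed.

(* [|c| <= t + c^2 / t]. *)
Lemma Rintegral_norm_le D c (t : R) : measurable D -> (mu D < +oo)%E ->
  measurable_fun D c -> 0 < t ->
  (\int[mu]_(x in D) (c x ^+ 2)%:E < (t ^+ 2)%:E)%E ->
  mu.-integrable D (EFin \o c) /\
  \int[mu]_(x in D) `|c x| <= t * (fine (mu D) + 1).
Proof.
move=> mD Doo mc t0 ct.
have ic2 : mu.-integrable D (EFin \o (fun x => c x ^+ 2)).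
  apply/integrableP; split; first by apply/measurable_EFinP; exact: measurable_funX.
  apply: le_lt_trans (lt_trans ct (ltry _)); rewrite le_eqVlt; apply/orP; left.
  by apply/eqP; apply: eq_integral => x _ /=; rewrite ger0_norm// sqr_ge0.
have ic := integrable_sqr mD Doo mc ic2.
split => //.
have i1 : mu.-integrable D (EFin \o (fun=> t : R)).
  exact: (@integrable_bounded _ _ `|t|).
have i2 : mu.-integrable D (EFin \o (fun x => t^-1 * c x ^+ 2)).
  exact: (integrableZl mD t^-1 ic2).
apply: (@le_trans _ _ (\int[mu]_(x in D) (t + t^-1 * c x ^+ 2))).
  apply: le_Rintegral => //; first exact: integrable_norm.
    by apply: (integrableD mD i1 i2).
  move=> x _; rewrite -(real_normK (num_real (c x))).
  have [ct'|ct'] := leP `|c x| t.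
    by rewrite (le_trans ct')// lerDl mulr_ge0 ?sqr_ge0// invr_ge0 ltW.
  rewrite -[leLHS]add0r; apply: lerD; first exact: ltW.
  by rewrite [leRHS]mulrC ler_pdivlMr// expr2 ler_wpM2l// ltW.
rewrite RintegralD// RintegralZl// Rintegral_cst// mulrDr mulr1 lerD2l.
rewrite mulrC ler_pdivrMr// -expr2 -lee_fin /Rintegral fineK; first exact: ltW.
exact: integrable_fin_num.
Qed.

End square_integrable.

Section approximation_by_parts.
Context {R : realType} {n : nat}.
Local Notation leb := (lebesgue_rV n).

(** Here [b] stands for a function of zero trace and [a] for its derivative. The identity holds for
    the approximating test functions, and the errors tend to 0 in L^1 while [h] and [dh] stay
    bounded. *)
Lemma Rintegral_by_parts (Omega : set 'rV[R]_n) (a b : 'rV[R]_n -> R)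
    (h dh : R -> R) (j m : 'I_n) (M : R) :
  measurable Omega -> (leb Omega < +oo)%E ->
  (a \_ Omega) \in Lfun leb 2 -> (b \_ Omega) \in Lfun leb 2 ->
  (forall e, 0 < e -> exists2 phi, test_function Omega phi &
    (\int[leb]_(x in Omega) ((b x - phi x) ^+ 2)%:E < e%:E)%E /\
    (\int[leb]_(x in Omega) ((a x - partial m phi x) ^+ 2)%:E < e%:E)%E) ->
  (forall t : R, is_derive t 1 h (dh t)) -> continuous dh ->
  (forall t, `|h t| <= M) -> (forall t, `|dh t| <= M) ->
  \int[leb]_(x in Omega) (a x * h (x ord0 j)) =
  - \int[leb]_(x in Omega) (b x * ((m == j)%:R * dh (x ord0 j))).
Proof.
move=> mO Ooo aL bL approx hdh cdh hM dhM.
have [ma ia] := Lfun2_restrict mO Ooo aL.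
have [mb ib] := Lfun2_restrict mO Ooo bL.
pose g (x : 'rV[R]_n) := h (x ord0 j).
pose dg (x : 'rV[R]_n) := (m == j)%:R * dh (x ord0 j).
have cg : continuous g by exact: continuous_comp_coord (is_derive_continuous hdh).
have cdg : continuous dg.
  apply: (@continuous_comp_coord _ _ (fun t => (m == j)%:R * dh t)) => t.
  exact: (cvgM (cvg_cst _) (cdh t)).
have mg : measurable_fun Omega g.
  exact: measurable_funS (continuous_measurable_rV cg).
have mdg : measurable_fun Omega dg.
  exact: measurable_funS (continuous_measurable_rV cdg).
have M0 : 0 <= M by rewrite (le_trans _ (hM 0)).
have gM x : Omega x -> `|g x| <= M by move=> _; exact: hM.
have dgM x : Omega x -> `|dg x| <= M.
  move=> _; rewrite /dg normrM; case: eqP => _; last by rewrite normr0 mul0r.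
  by rewrite normr1 mul1r.
apply/eqP; rewrite -subr_eq0 opprK; apply/eqP.
set S := (X in X = 0).
(* Each of the two error integrals is at most [t * (fine (leb Omega) + 1)] times the bound [M] of
   its weight. *)
pose A := 2 * (M * (fine (leb Omega) + 1)).
have A0 : 0 <= A by rewrite !mulr_ge0// addr_ge0// fine_ge0.
suff H t : 0 < t -> `|S| <= t * A.
  apply/eqP; rewrite -normr_le0; apply/ler_addgt0Pl => e e0; rewrite addr0.
  have A1 : 0 < A + 1 by rewrite ltr_wpDl.
  rewrite (le_trans (H (e / (A + 1)) _)) ?divr_gt0//.
  by rewrite -mulrA ger_pMr// mulrC ler_pdivrMr// mul1r lerDl.
move=> t0; have [phi tphi [b1 a1]] := approx _ (exprn_gt0 2 t0).
have [cphi _ cdphi] := test_function_C1 tphi.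
have mphi : measurable_fun Omega phi.
  exact: measurable_funS (continuous_measurable_rV cphi).
have mdphi : measurable_fun Omega (partial m phi).
  exact: measurable_funS (continuous_measurable_rV (cdphi m)).
have [ib' b2] := Rintegral_norm_le mO Ooo (measurable_funB mb mphi) t0 b1.
have [ia' a2] := Rintegral_norm_le mO Ooo (measurable_funB ma mdphi) t0 a1.
have Z := Rintegral_test_by_parts j m mO tphi hdh cdh.
have [_ /(_ m) ip1] := integrable_test mO tphi cg.
have [ip2 _] := integrable_test mO tphi cdg.
have I1 := integrable_boundedM mO ia' mg gM.
have I2 := integrable_boundedM mO ib' mdg dgM.
(* The contributions of [phi] cancel by [Z]. *)
have -> : S = \int[leb]_(x in Omega) ((a x - partial m phi x) * g x)
            + \int[leb]_(x in Omega) ((b x - phi x) * dg x).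
  have -> : \int[leb]_(x in Omega) ((a x - partial m phi x) * g x) =
      \int[leb]_(x in Omega) (a x * g x) - \int[leb]_(x in Omega) (g x * partial m phi x).
    rewrite -RintegralB//; last exact: integrable_boundedM ia mg gM.
    by apply: eq_Rintegral => x _; rewrite mulrBl [partial m phi x * _]mulrC.
  have -> : \int[leb]_(x in Omega) ((b x - phi x) * dg x) =
      \int[leb]_(x in Omega) (b x * dg x) - \int[leb]_(x in Omega) (dg x * phi x).
    rewrite -RintegralB//; last exact: integrable_boundedM ib mdg dgM.
    by apply: eq_Rintegral => x _; rewrite mulrBl [phi x * _]mulrC.
  rewrite /S Z -/g; rewrite opprK addrACA; rewrite subrr addr0.
  by [].
have bound (c k : 'rV[R]_n -> R) : leb.-integrable Omega (EFin \o c) ->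
    measurable_fun Omega k -> (forall x, Omega x -> `|k x| <= M) ->
    \int[leb]_(x in Omega) `|c x| <= t * (fine (leb Omega) + 1) ->
    `|\int[leb]_(x in Omega) (c x * k x)| <= M * (t * (fine (leb Omega) + 1)).
  move=> ic mk kM cle; have ick := integrable_boundedM mO ic mk kM.
  rewrite (le_trans (le_normr_Rintegral mO ick))//.
  apply: (@le_trans _ _ (\int[leb]_(x in Omega) (M * `|c x|))).
    apply: le_Rintegral => //; first exact: integrable_norm.
      exact: (integrableZl mO M (integrable_norm ic)).
    by move=> x Ox; rewrite normrM mulrC ler_wpM2r// kM.
  by rewrite RintegralZl ?ler_wpM2l//; exact: integrable_norm.
rewrite (le_trans (ler_normD _ _))//.
rewrite (le_trans (lerD (bound _ _ ia' mg gM a2) (bound _ _ ib' mdg dgM b2)))//.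
by rewrite le_eqVlt; apply/orP; left; apply/eqP; rewrite /A; ring.
Qed.

End approximation_by_parts.

(** * Sobolev functions and the shear wave *)

Section complex_parts.
Context {R : realType}.
Local Open Scope complex_scope.
Local Notation C := R[i].

(** The boolean lets every real argument be made once for both parts of a complex function. *)
Definition part (b : bool) (z : C) : R := if b then complex.Im z else complex.Re z.

Lemma partD b (z y : C) : part b (z + y) = part b z + part b y.
Proof. by case: b z y => -[? ?] [? ?]. Qed.

Lemma partN b (z : C) : part b (- z) = - part b z.
Proof. by case: b z => -[? ?]. Qed.

Lemma partMr b (z : C) (r : R) : part b (z * r%:C) = part b z * r.
Proof. by case: b z => -[? ?] /=; rewrite mulr0 ?subr0 ?add0r. Qed.

Lemma partMl b (z : C) (r : R) : part b (r%:C * z) = r * part b z.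
Proof. by rewrite mulrC partMr mulrC. Qed.

Lemma cabs_sqr (z : C) : cabs z ^+ 2 = complex.Re z ^+ 2 + complex.Im z ^+ 2.
Proof. by case: z => a b; rewrite /cabs normc_def /= sqr_sqrtr// addr_ge0 ?sqr_ge0. Qed.

Lemma cabs_ge0 (z : C) : 0 <= cabs z.
Proof. by case: z => a b; rewrite /cabs normc_def /= sqrtr_ge0. Qed.

Lemma cabsE (z : C) : `|z| = (cabs z)%:C.
Proof. by case: z => a b; rewrite /cabs normc_def. Qed.

Lemma cabsM (z y : C) : cabs (z * y) = cabs z * cabs y.
Proof.
have : (cabs (z * y))%:C = (cabs z * cabs y)%:C.
  by rewrite -cabsE normrM !cabsE rmorphM.
by case.
Qed.

Lemma cabsD (z y : C) : cabs (z + y) <= cabs z + cabs y.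
Proof. by rewrite -lecR rmorphD/= -!cabsE ler_normD. Qed.

Lemma part_cabs b (z : C) : `|part b z| <= cabs z.
Proof.
rewrite -(ler_sqr (normr_ge0 _) (cabs_ge0 _)) cabs_sqr real_normK ?num_real//.
by case: b; rewrite /part ?lerDl ?lerDr sqr_ge0.
Qed.

(** The sharp factor is the square root of 2; the cruder 2 is one of the two factors of the constant
    4 in the interior bound. *)
Lemma cabs_le (z : C) (M : R) : 0 <= M -> (forall b, `|part b z| <= M) ->
  cabs z <= 2 * M.
Proof.
move=> M0 zM; have M20 : 0 <= 2 * M by rewrite mulr_ge0.
rewrite -(ler_sqr (cabs_ge0 _) M20) cabs_sqr.
have := zM true; have := zM false; rewrite /part.
rewrite -(real_normK (num_real (complex.Re z))) -(real_normK (num_real (complex.Im z))).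
have := normr_ge0 (complex.Re z); have := normr_ge0 (complex.Im z).
nra.
Qed.

Lemma part_cintegral n (Omega : set 'rV[R]_n) (f : 'rV[R]_n -> C) b :
  part b (cintegral Omega f) = \int[lebesgue_rV n]_(x in Omega) part b (f x).
Proof. by case: b. Qed.

Lemma eq_cintegral n (Omega : set 'rV[R]_n) (f : 'rV[R]_n -> C) (z : C) :
  (forall b, \int[lebesgue_rV n]_(x in Omega) part b (f x) = part b z) ->
  cintegral Omega f = z.
Proof. by case: z => x y H; rewrite /cintegral (H true) (H false). Qed.

End complex_parts.

Section sobolev.
Context {R : realType} {n : nat}.
Local Open Scope complex_scope.
Local Notation leb := (lebesgue_rV n).
Implicit Types (Omega : set 'rV[R]_n).

Lemma Lfun2_bounded Omega (c : 'rV[R]_n -> R) (M : R) :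
  measurable Omega -> (leb Omega < +oo)%E ->
  measurable_fun Omega c -> (forall x, Omega x -> `|c x| <= M) ->
  (c \_ Omega) \in Lfun leb 2.
Proof.
move=> mO Ooo mc cM.
have mc' : measurable_fun setT (c \_ Omega) by apply: (measurable_restrictT c mO).1.
rewrite inE; apply/andP; split; rewrite inE//=.
rewrite /finite_norm unlock; apply: poweR_lty.
have : leb.-integrable Omega (EFin \o (fun x => c x ^+ 2)).
  apply: (@integrable_bounded _ _ _ _ _ _ (M ^+ 2)) => //; first exact: measurable_funX.
  by move=> x /cM cx; rewrite normrX lerXn2r// nnegrE (le_trans _ cx).
move=> /(integrable_mkcond _ mO)/integrableP[_]; apply: le_lt_trans.
rewrite le_eqVlt; apply/orP; left; apply/eqP; apply: eq_integral => x _ /=.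
rewrite !patchE; case: ifPn => _ /=; last by rewrite normr0 powR0 ?abse0// pnatr_eq0.
by rewrite powR_mulrn// normrX.
Qed.

Lemma Lp_part Omega (f : 'rV[R]_n -> R[i]) p b :
  Lp p Omega f -> ((part b \o f) \_ Omega) \in Lfun leb p.
Proof. by case: b => -[]. Qed.

(** The squared modulus dominates the square of each part, so one complex approximation yields a
    real one for either part. *)
Lemma H10_approx Omega f (G : 'I_n -> 'rV[R]_n -> R[i]) b (m : 'I_n) :
  measurable Omega -> (leb Omega < +oo)%E -> H10 Omega f G ->
  forall e : R, 0 < e -> exists2 phi, test_function Omega phi &
    (\int[leb]_(x in Omega) ((part b (f x) - phi x) ^+ 2)%:E < e%:E)%E /\
    (\int[leb]_(x in Omega) ((part b (G m x) - partial m phi x) ^+ 2)%:E < e%:E)%E.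
Proof.
move=> mO Ooo [[fL /(_ m)[GL _]] approx] e e0.
have [phi [psi [tphi tpsi ef /(_ m) eG]]] := approx e e0.
have part_le (c : 'rV[R]_n -> R[i]) (p q : 'rV[R]_n -> R) :
    (forall b, measurable_fun Omega (fun x => part b (c x))) ->
    measurable_fun Omega p -> measurable_fun Omega q ->
    (\int[leb]_(x in Omega) ((part b (c x) - (if b then q else p) x) ^+ 2)%:E <=
     \int[leb]_(x in Omega) (cabs (c x - (p x +i* q x)) ^+ 2)%:E)%E.
  move=> mc mp mq; apply: ge0_le_integral => //.
  - by move=> x _; rewrite lee_fin sqr_ge0.
  - apply/measurable_EFinP; apply: measurable_funX; apply: measurable_funB => //.
    by case: b.
  - apply/measurable_EFinP.
    rewrite (_ : (fun x => _) = (fun x => (part false (c x) - p x) ^+ 2 +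
        (part true (c x) - q x) ^+ 2)).
      by apply: measurable_funD; apply: measurable_funX; apply: measurable_funB.
    by apply/funext => x; rewrite cabs_sqr /part; case: (c x).
  - move=> x _; rewrite lee_fin cabs_sqr; case: (c x) => y z /=.
    by case: b; rewrite ?lerDl ?lerDr sqr_ge0.
have mL c : Lp 2%:E Omega c -> forall b, measurable_fun Omega (fun x => part b (c x)).
  by move=> cL b'; have [] := Lfun2_restrict mO Ooo (Lp_part b' cL).
have mt phi' : test_function Omega phi' ->
    measurable_fun Omega phi' /\ measurable_fun Omega (partial m phi').
  move=> /test_function_C1[c1 _ /(_ m) c2].
  by split; apply: measurable_funS (continuous_measurable_rV _).
have [mphi mdphi] := mt _ tphi; have [mpsi mdpsi] := mt _ tpsi.
have H1 := part_le _ _ _ (mL _ fL) mphi mpsi.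
have H2 := part_le _ _ _ (mL _ GL) mdphi mdpsi.
exists (if b then psi else phi); first by case: (b).
split; first exact: le_lt_trans ef.
by apply: le_lt_trans eG; case: (b) H2.
Qed.

(** The zero trace is carried by [f], so the weight [h] is free at the boundary. *)
Lemma H10_by_parts Omega f (G : 'I_n -> 'rV[R]_n -> R[i]) b (h dh : R -> R)
    (j m : 'I_n) (M : R) :
  measurable Omega -> (leb Omega < +oo)%E -> H10 Omega f G ->
  (forall t : R, is_derive t 1 h (dh t)) -> continuous dh ->
  (forall t, `|h t| <= M) -> (forall t, `|dh t| <= M) ->
  \int[leb]_(x in Omega) (part b (G m x) * h (x ord0 j)) =
  - \int[leb]_(x in Omega) (part b (f x) * ((m == j)%:R * dh (x ord0 j))).
Proof.
move=> mO Ooo HfG; have [[fL /(_ m)[GL _]] _] := HfG.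
move=> hdh cdh hM dhM.
apply: Rintegral_by_parts hdh cdh hM dhM => //.
- exact: Lp_part GL.
- exact: Lp_part fL.
- exact: H10_approx HfG.
Qed.

Lemma H1_comp_coord Omega (h dh : R -> R) (j : 'I_n) (M : R) :
  measurable Omega -> (leb Omega < +oo)%E ->
  (forall t : R, is_derive t 1 h (dh t)) -> continuous dh ->
  (forall t, `|h t| <= M) -> (forall t, `|dh t| <= M) ->
  H1 Omega (fun x => (h (x ord0 j))%:C)
    (fun m x => ((m == j)%:R * dh (x ord0 j))%:C).
Proof.
move=> mO Ooo hdh cdh hM dhM.
have ch := is_derive_continuous hdh.
have L2 (c : 'rV[R]_n -> R) : continuous c -> (forall x, `|c x| <= M) ->
    Lp 2%:E Omega (fun x => (c x)%:C).
  move=> cc cM; split => /=.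
    apply: (Lfun2_bounded (M := M)) => //.
    exact: measurable_funS (continuous_measurable_rV cc).
  apply: (Lfun2_bounded (M := 0)) => //.
  by move=> x _; rewrite normr0.
split; first by apply: L2 => //; exact: continuous_comp_coord.
move=> m; split.
  apply: L2.
    apply: (@continuous_comp_coord _ _ (fun t => (m == j)%:R * dh t)) => t.
    exact: (cvgM (cvg_cst _) (cdh t)).
  move=> x; rewrite normrM; case: eqP => _; first by rewrite normr1 mul1r.
  by rewrite normr0 mul0r (le_trans _ (hM 0)).
move=> phi tphi; apply: eq_cintegral => b.
have real b' (c d : 'rV[R]_n -> R) :
    \int[leb]_(x in Omega) part b' ((c x)%:C * (d x)%:C) =
    if b' then 0 else \int[leb]_(x in Omega) (c x * d x).
  under eq_Rintegral do rewrite partMr; case: b' => //=.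
  by under eq_Rintegral do rewrite mul0r; rewrite /Rintegral integral0.
rewrite partN part_cintegral !real; case: b => //; first by rewrite oppr0.
exact: Rintegral_test_by_parts.
Qed.

End sobolev.

Section shear_wave.
Context {R : realType}.
Implicit Types (k a t : R).

Lemma is_derive_affine k a t : is_derive t (1 : R) (fun s => k * (s - a)) k.
Proof.
apply: is_derive_eq (is_deriveZ k (is_derive_shift t 1 (- a))) _.
by rewrite /GRing.scale/= mulr1.
Qed.

Lemma is_derive_cos_affine k a t :
  is_derive t 1 (fun s => cos (k * (s - a))) (- (k * sin (k * (t - a)))).
Proof.
apply: is_derive_eq (is_derive1_comp (is_derive_cos _) (is_derive_affine k a t)) _.
by rewrite mulNr mulrC.
Qed.

Lemma is_derive_sin_affine k a t :
  is_derive t 1 (fun s => - (k * sin (k * (s - a)))) (- (k ^+ 2 * cos (k * (t - a)))).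
Proof.
apply: is_derive_eq (is_deriveN (is_deriveZ k
  (is_derive1_comp (is_derive_sin _) (is_derive_affine k a t)))) _.
by rewrite /GRing.scale/= expr2 -mulrA [cos _ * k]mulrC.
Qed.

Lemma continuous_sin_affine k a : continuous (fun t => - (k * sin (k * (t - a)))).
Proof. exact: is_derive_continuous (is_derive_sin_affine k a). Qed.

Lemma continuous_cos_affine k a : continuous (fun t => - (k ^+ 2 * cos (k * (t - a)))).
Proof.
move=> t; apply: (cvgN (cvgM (cvg_cst _) _)).
exact: is_derive_continuous (is_derive_cos_affine k a) t.
Qed.

End shear_wave.

Section orthogonality.
Context {R : realType} {n : nat}.
Local Open Scope complex_scope.
Local Notation leb := (lebesgue_rV n).

(** The divergence term points along [e_j] and has no component [i]; the rotation term contributes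
    [G j i - G i j] and so symmetrizes [2 G i j]. The result is a shear stress. *)
Lemma traction_offdiag (lam mu : R) (G : 'M[R[i]]_n) (i j : 'I_n) :
  n = 2%N \/ n = 3%N -> i != j ->
  traction lam mu G (delta_mx ord0 j) ord0 i = mu%:C * (G i j + G j i).
Proof.
move=> n23 ij.
have E : traction lam mu G (delta_mx ord0 j) ord0 i =
    (2 * mu)%:C * G i j + mu%:C * rotation G (delta_mx ord0 j) ord0 i.
  rewrite /traction !mxE (negbTE ij) andbF mulr0 addr0; congr (_ * _ + _).
  rewrite (bigD1 j)//= big1 ?addr0 => [|l lj]; first by rewrite !mxE !eqxx mul1r.
  by rewrite !mxE (negbTE lj) andbF mul0r.
suff rotE : rotation G (delta_mx ord0 j) ord0 i = G j i - G i j.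
  by rewrite E rotE rmorphM/= rmorph_nat; ring.
case: n23 => n_; subst n.
- have two (l : 'I_2) : l = 0 \/ l = 1.
    by case: l => -[|[|//]] H; [left|right]; exact: val_inj.
  by case: (two i) ij => ->; case: (two j) => -> // _; rewrite /= /rotation2 !mxE/=; ring.
- have three (l : 'I_3) : [\/ l = 0, l = 1 | l = 2%:R].
    by case: l => -[|[|[|//]]] H; [constructor 1|constructor 2|constructor 3];
      exact: val_inj.
  by case: (three i) ij => ->; case: (three j) => -> // _;
    rewrite /= /cross3 /curl3 !mxE/=; ring.
Qed.

Lemma transmission_orthogonality (lam mu omega a : R) (Omega : set 'rV[R]_n)
    (V : 'rV[R]_n -> R[i]) (w v : 'rV[R]_n -> 'rV[R[i]]_n) (i j : 'I_n) b :
  n = 2%N \/ n = 3%N -> i != j -> 0 < mu -> 0 < omega ->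
  measurable Omega -> (leb Omega < +oo)%E ->
  transmission_eigenfunctions lam mu Omega V omega w v ->
  leb.-integrable Omega (EFin \o (fun x => part b (V x * w x ord0 i))) ->
  \int[leb]_(x in Omega) (part b (V x * w x ord0 i) *
     cos (omega / Num.sqrt mu * (x ord0 j - a))) = 0.
Proof.
move=> n23 ij mu0 om0 mO Ooo [[wL vL] _ _ _ [Du HDu ZT]] iVw.
set k := omega / Num.sqrt mu.
have k0 : 0 < k by rewrite divr_gt0// sqrtr_gt0.
have muk : mu * k ^+ 2 = omega ^+ 2.
  rewrite expr_div_n sqr_sqrtr ?ltW// mulrCA mulfV ?mulr1// gt_eqF//.
pose c t := cos (k * (t - a)).
pose dc t := - (k * sin (k * (t - a))).
pose ddc t := - (k ^+ 2 * c t).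
(* One bound for [c], [dc] and [ddc], as integration by parts takes a common bound for a weight and
   its derivative. *)
pose M := 1 + k + k ^+ 2.
have M1 : 1 <= M by rewrite /M -addrA lerDl addr_ge0 ?sqr_ge0 ?ltW.
have cM t : `|c t| <= M by rewrite (le_trans (cos_max _)).
have dcM t : `|dc t| <= M.
  rewrite normrN normrM gtr0_norm// (le_trans (ler_wpM2l (ltW k0) (sin_max _)))//.
  by rewrite mulr1 /M addrAC lerDr addr_ge0 ?sqr_ge0.
have ddcM t : `|ddc t| <= M.
  rewrite normrN normrM ger0_norm ?sqr_ge0//.
  rewrite (le_trans (ler_wpM2l (sqr_ge0 k) (cos_max _)))//.
  by rewrite mulr1 /M lerDr addr_ge0 ?ltW.
(* Written with an indicator, all components of the wave, zero or not, are handled by the same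
   [H1_comp_coord]. *)
pose h (l : 'I_n) t : R := (l == i)%:R * c t.
pose dh (l : 'I_n) t : R := (l == i)%:R * dc t.
have hdh l (t : R) : is_derive t (1 : R) (h l) (dh l t).
  rewrite /h /dh; case: (l == i).
    rewrite mul1r (_ : (fun _ => _) = c); last by apply/funext => s; rewrite mul1r.
    exact: is_derive_cos_affine.
  rewrite mul0r (_ : (fun _ => _) = cst 0); last by apply/funext => s; rewrite mul0r.
  exact: is_derive_cst.
have cdc : continuous dc by exact: continuous_sin_affine.
have cdh l : continuous (dh l).
  by move=> t; exact: (cvgM (cvg_cst _) (cdc t)).
have ind (l : 'I_n) (r : R) : `|r| <= M -> `|(l == i)%:R * r| <= M.
  move=> rM; rewrite normrM; case: eqP => _; first by rewrite normr1 mul1r.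
  by rewrite normr0 mul0r (le_trans ler01).
pose Phi (x : 'rV[R]_n) : 'rV[R[i]]_n := \row_l (h l (x ord0 j))%:C.
pose DPhi (x : 'rV[R]_n) : 'M[R[i]]_n :=
  \matrix_(l, m) ((m == j)%:R * dh l (x ord0 j))%:C.
have HPhi : H1v Omega Phi DPhi.
  move=> l.
  rewrite (_ : Defs.coord Phi l = fun x => (h l (x ord0 j))%:C); last first.
    by apply/funext => x; rewrite /Defs.coord mxE.
  rewrite (_ : (fun m x => DPhi x l m) =
      fun m x => ((m == j)%:R * dh l (x ord0 j))%:C); last first.
    by apply/funext => m; apply/funext => x; rewrite mxE.
  by apply: (@H1_comp_coord _ _ Omega (h l) (dh l) j M) => // t; exact: ind.
have := ZT _ _ HPhi; rewrite /traction_pairing => /(congr1 (part b)).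
rewrite part_cintegral.
pose u x := w x - v x.
have E x : part b
    (\sum_m \sum_l traction lam mu (Du x) (delta_mx ord0 m) ord0 l * DPhi x l m
    + \sum_l ((- (omega ^+ 2)%:C *: ((1 + V x) *: w x)) -
       (- (omega ^+ 2)%:C *: v x)) ord0 l * Phi x ord0 l) =
  mu * (part b (Du x i j) * dc (x ord0 j)) + mu * (part b (Du x j i) * dc (x ord0 j))
   - omega ^+ 2 * (part b (Defs.coord u i x) * c (x ord0 j))
   - omega ^+ 2 * (part b (V x * w x ord0 i) * c (x ord0 j)).
  have -> : \sum_m \sum_l
      traction lam mu (Du x) (delta_mx ord0 m) ord0 l * DPhi x l m =
      mu%:C * (Du x i j + Du x j i) * (dc (x ord0 j))%:C.
    rewrite (bigD1 j)//= [X in _ + X]big1 ?addr0 => [|m mj]; last first.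
      by apply: big1 => l _; rewrite [DPhi _ _ _]mxE (negbTE mj) mul0r mulr0.
    rewrite (bigD1 i)//= [X in _ + X]big1 ?addr0 => [|l li]; last first.
      by rewrite [DPhi _ _ _]mxE /dh (negbTE li) mul0r mulr0 mulr0.
    by rewrite traction_offdiag// [DPhi _ _ _]mxE /dh !eqxx !mul1r.
  rewrite (bigD1 i)//= [X in _ + (_ + X)]big1 ?addr0 => [|l li]; last first.
    by rewrite [Phi x _ _]mxE /h (negbTE li) mul0r mulr0.
  rewrite [Phi x _ _]mxE /h eqxx mul1r partD !partMr partMl partD.
  have -> : ((- (omega ^+ 2)%:C *: ((1 + V x) *: w x)) -
       (- (omega ^+ 2)%:C *: v x)) ord0 i =
      (- omega ^+ 2)%:C * (Defs.coord u i x + V x * w x ord0 i).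
    by rewrite /Defs.coord /u !mxE rmorphN/=; ring.
  by rewrite partMl partD; ring.
under eq_Rintegral do rewrite E.
have -> : part b (0 : R[i]) = 0 by case: (b).
have DL l m : leb.-integrable Omega (EFin \o (fun x => part b (Du x l m))).
  have [[_ /(_ m)[GL _]] _] := HDu l.
  by have [] := Lfun2_restrict mO Ooo (Lp_part b GL).
have uL l : leb.-integrable Omega (EFin \o (fun x => part b (Defs.coord u l x))).
  have [[fL _] _] := HDu l.
  by have [] := Lfun2_restrict mO Ooo (Lp_part b fL).
have mc : measurable_fun Omega (fun x => c (x ord0 j)).
  apply: measurable_funS (continuous_measurable_rV _) => //.
  apply: continuous_comp_coord; apply: is_derive_continuous (is_derive_cos_affine k a).
have mdc : measurable_fun Omega (fun x => dc (x ord0 j)).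
  apply: measurable_funS (continuous_measurable_rV _) => //.
  apply: continuous_comp_coord; exact: continuous_sin_affine.
have ID l m := integrable_boundedM mO (DL l m) mdc (fun x _ => dcM (x ord0 j)).
have Iu l := integrable_boundedM mO (uL l) mc (fun x _ => cM (x ord0 j)).
have IV := integrable_boundedM mO iVw mc (fun x _ => cM (x ord0 j)).
have Z (r : R) f : leb.-integrable Omega (EFin \o f) ->
    leb.-integrable Omega (EFin \o (fun x => r * f x)).
  by move=> If; exact: (integrableZl mO r If).
have ZD f g : leb.-integrable Omega (EFin \o f) ->
    leb.-integrable Omega (EFin \o g) ->
    leb.-integrable Omega (EFin \o (fun x => f x + g x)).
  by move=> If Ig; exact: (integrableD mO If Ig).
have ZB f g : leb.-integrable Omega (EFin \o f) ->
    leb.-integrable Omega (EFin \o g) ->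
    leb.-integrable Omega (EFin \o (fun x => f x - g x)).
  by move=> If Ig; exact: (integrableB mO If Ig).
rewrite RintegralB//; [|by apply: ZB; [apply: ZD|]; exact: Z|exact: Z].
rewrite RintegralB//; [|by apply: ZD; exact: Z|exact: Z].
rewrite RintegralD//; [|exact: Z|exact: Z].
rewrite !RintegralZl//.
have byp l m := H10_by_parts b j m mO Ooo (HDu l) (is_derive_sin_affine k a)
   (@continuous_cos_affine R k a) dcM ddcM.
(* The derivative in direction [j] falls on [dc], and [ddc = - k^2 c]. *)
have -> : \int[leb]_(x in Omega) (part b (Du x i j) * dc (x ord0 j)) =
    k ^+ 2 * \int[leb]_(x in Omega) (part b (Defs.coord u i x) * c (x ord0 j)).
  rewrite (byp i j) eqxx /= -RintegralZl// -mulN1r -RintegralZl//; last first.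
    rewrite (_ : (fun _ => _) = fun x => - k ^+ 2 *
        (part b (Defs.coord u i x) * c (x ord0 j))); first exact: Z.
    by apply/funext => x; rewrite /c; ring.
  by apply: eq_Rintegral => x _; rewrite /c; ring.
(* The wave does not vary in direction [i]. *)
have -> : \int[leb]_(x in Omega) (part b (Du x j i) * dc (x ord0 j)) = 0.
  rewrite (byp j i) (negbTE ij) /=; under eq_Rintegral do rewrite mul0r mulr0.
  by rewrite /Rintegral integral0 oppr0.
(* Since [mu k^2 = omega^2], the terms in [u] cancel and only the one in [V w] remains. *)
rewrite mulr0 addr0 mulrA muk subrr add0r => /eqP.
by rewrite oppr_eq0 mulf_eq0 sqrf_eq0 (gt_eqF om0) => /eqP.
Qed.

End orthogonality.

(** * Hölder functions and boundary values *)

Local Notation edist := Defs.edist.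

Section euclidean.
Context {R : realType} {n : nat}.
Implicit Types (x y z : 'rV[R]_n) (Omega : set 'rV[R]_n).

Lemma ler_coord_norm z i : `|z ord0 i| <= `|z|.
Proof.
rewrite [leRHS]mx_normrE.
exact: (le_bigmax _ (fun ij : 'I_1 * 'I_n => `|z ij.1 ij.2|) (ord0, i)).
Qed.

Lemma dotp_ge0 z : 0 <= dotp z z.
Proof. by apply: sumr_ge0 => i _; rewrite -expr2 sqr_ge0. Qed.

Lemma euclidean_ge0 x y : 0 <= edist x y. Proof. exact: sqrtr_ge0. Qed.

Lemma edist_sqr x y : edist x y ^+ 2 = dotp (x - y) (x - y).
Proof. by rewrite sqr_sqrtr// dotp_ge0. Qed.

Lemma ler_coord_edist x y i : `|x ord0 i - y ord0 i| <= edist x y.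
Proof.
rewrite -(ler_sqr (normr_ge0 _) (euclidean_ge0 _ _)) edist_sqr /dotp (bigD1 i)//=.
rewrite !mxE -expr2 real_normK ?num_real// lerDl sumr_ge0// => l _.
by rewrite -expr2 sqr_ge0.
Qed.

Lemma euclidean_gt0 x y : x != y -> 0 < edist x y.
Proof.
move=> xy; rewrite lt_def euclidean_ge0 andbT; apply: contra xy => /eqP xy0.
apply/eqP/rowP => i; apply/eqP; rewrite -subr_eq0 -normr_le0.
by rewrite -xy0 ler_coord_edist.
Qed.

Lemma sqrt_sum_le (m : nat) (c : 'I_m -> R) (X : R) :
  0 <= X -> (forall i, `|c i| <= X) -> Num.sqrt (\sum_i c i ^+ 2) <= m%:R * X.
Proof.
move=> X0 cX; have mX : 0 <= m%:R * X by rewrite mulr_ge0.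
rewrite -(ler_sqr (sqrtr_ge0 _) mX) sqr_sqrtr; last first.
  by apply: sumr_ge0 => i _; exact: sqr_ge0.
apply: (@le_trans _ _ (m%:R * X ^+ 2)).
  rewrite -[X in X%:R * _]card_ord mulr_natl -sumr_const; apply: ler_sum => i _.
  by rewrite -(real_normK (num_real (c i))) lerXn2r// nnegrE.
rewrite exprMn ler_wpM2r ?sqr_ge0// expr2 -natrM ler_nat.
by case: (m) => // k; rewrite leq_pmulr.
Qed.

(** The topology is that of the sup norm; this carries Euclidean Hölder bounds over to it. *)
Lemma edist_le_norm x y : edist x y <= n%:R * `|x - y|.
Proof.
rewrite /edist /dotp; under eq_bigr do rewrite -expr2.
by apply: sqrt_sum_le => // i; exact: ler_coord_norm.
Qed.

Lemma edist_le_ediam Omega x y : bounded_set Omega ->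
  Omega x -> Omega y -> edist x y <= ediam Omega.
Proof.
move=> [M [_ OM]] Ox Oy; apply: ub_le_sup; last by exists x, y.
(* [M + 1] because [bounded_set] bounds norms only by numbers strictly above [M]. *)
exists (n%:R * ((M + 1) + (M + 1))) => _ [x' [y' [Ox' Oy' ->]]].
rewrite (le_trans (edist_le_norm _ _))// ler_wpM2l// (le_trans (ler_normB _ _))//.
by apply: lerD; apply: (OM (M + 1)) => //; rewrite ltrDl.
Qed.

Lemma ediam_ge0 Omega : bounded_set Omega -> Omega !=set0 -> 0 <= ediam Omega.
Proof.
move=> bO [x Ox].
by rewrite (le_trans _ (edist_le_ediam bO Ox Ox))// euclidean_ge0.
Qed.

(** Without two distinct points the supremum in the Hölder seminorm would be taken over the empty
    set and equal [-oo]. *)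
Lemma open_two_points Omega x (i : 'I_n) : open Omega -> Omega x ->
  exists2 y, Omega y & x != y.
Proof.
move=> oO Ox; have /nbhs_ballP[e /= e0 xO] := open_nbhs_nbhs (conj oO Ox).
exists (x + (e / 2) *: delta_mx ord0 i).
  apply: xO; rewrite ball_rVE// => l; rewrite /ball/= !mxE eqxx/=.
  rewrite opprD addNKr normrN normrM gtr0_norm ?divr_gt0//.
  case: eqP => _; rewrite ?normr1 ?normr0 ?mulr1 ?mulr0//.
  by rewrite ltr_pdivrMr// ltr_pMr// ltr1n.
apply/eqP => /rowP/(_ i); rewrite !mxE !eqxx mulr1 => /eqP.
by rewrite -subr_eq0 opprD addNKr oppr_eq0 gt_eqF// divr_gt0.
Qed.

End euclidean.

Lemma powR_modulus (R : realType) (K delta e : R) : 0 <= K -> 0 < delta -> 0 < e ->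
  exists2 r, 0 < r & forall s, 0 <= s -> s < r -> K * s `^ delta < e.
Proof.
move=> K0 d0 e0; have K1 : 0 < K + 1 by rewrite ltr_wpDl.
have q0 : 0 < e / (K + 1) by rewrite divr_gt0.
exists ((e / (K + 1)) `^ delta^-1); first exact: powR_gt0.
move=> s s0 sr; apply: (@le_lt_trans _ _ (K * (e / (K + 1)))).
  rewrite ler_wpM2l//; apply: (@le_trans _ _ (((e / (K + 1)) `^ delta^-1) `^ delta)).
    by apply: ge0_ler_powR; rewrite ?nnegrE ?powR_ge0 ?(ltW d0) ?(ltW sr).
  by rewrite -powRrM mulVf ?gt_eqF// powRr1// ltW.
by rewrite mulrCA gtr_pMr// ltr_pdivrMr// mul1r ltrDl.
Qed.

Section holder.
Context {R : realType} {n : nat}.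
Variables (Omega : set 'rV[R]_n) (delta K : R) (f : 'rV[R]_n -> R[i]).
Hypotheses (d0 : 0 < delta) (K0 : 0 <= K).
Hypothesis fK : forall x y, Omega x -> Omega y ->
  cabs (f x - f y) <= K * `|x - y| `^ delta.

Lemma holder_near (x : 'rV[R]_n) (e : R) : 0 < e -> Omega x -> open Omega ->
  \forall y \near x, Omega y /\ cabs (f x - f y) < e.
Proof.
move=> e0 Ox oO; have [r r0 H] := powR_modulus K0 d0 e0.
have nO : nbhs x Omega by exact: open_nbhs_nbhs.
have nr : nbhs x (fun y => `|x - y| < r).
  by have := nbhsx_ballx x r r0; rewrite mx_norm_ball.
apply: filterS2 nO nr => y Oy yr; split => //.
exact: le_lt_trans (fK Ox Oy) (H _ (normr_ge0 _) yr).
Qed.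

Lemma holder_measurable b : open Omega ->
  measurable_fun Omega (fun x => part b (f x)).
Proof.
move=> oO; apply: continuous_measurable_within_rV => // x /set_mem Ox.
apply: (@cvgrPdist_lt _ _ _ (nbhs x) _ _ _).2 => e e0.
have := holder_near e0 Ox oO; apply: filterS => y [_]; apply: le_lt_trans.
by rewrite -partN -partD part_cabs.
Qed.

(** Uniform continuity makes the image of the trace filter at [p] a Cauchy filter, and the reals are
    complete; no value of [f] at [p] enters. *)
Lemma holder_cvg b (p : 'rV[R]_n) : closure Omega p ->
  cvg (part b (f x) @[x --> within Omega (nbhs p)]).
Proof.
move=> cp; have PF : ProperFilter (within Omega (nbhs p)).
  exact: within_nbhs_proper.
apply: cauchy_cvg; apply: cauchy_exP => e e0.
have [r r0 H] := powR_modulus K0 d0 e0.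
have r20 : 0 < r / 2 by rewrite divr_gt0.
have [x [Ox px]] := cp _ (nbhsx_ballx p _ r20).
exists (part b (f x)); rewrite /= /nbhs/= /within/=.
have := nbhsx_ballx p _ r20; apply: filterS => y py Oy.
apply: le_lt_trans (H `|x - y| _ _) => //.
  by rewrite -partN -partD (le_trans (part_cabs _ _))// fK.
have : ball x (r / 2 + r / 2) y by apply: ball_triangle py; exact: ball_sym.
by rewrite -splitr mx_norm_ball.
Qed.

(** [boundary_value] is made of [lim], which means something only once [holder_cvg] gives
    convergence of both parts. *)
Lemma holder_boundary (p : 'rV[R]_n) : closure Omega p ->
  cabs (f x) @[x --> within Omega (nbhs p)] --> cabs (boundary_value Omega f p).
Proof.
move=> cp; have PF : ProperFilter (within Omega (nbhs p)).
  exact: within_nbhs_proper.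
have cabs_sqrt z : cabs z = Num.sqrt (part false z ^+ 2 + part true z ^+ 2) :> R.
  by rewrite -cabs_sqr sqrtr_sqr ger0_norm// cabs_ge0.
rewrite cabs_sqrt; under eq_fun do rewrite cabs_sqrt.
apply: continuous_cvg; first exact: sqrt_continuous.
have H b : part b (f x) @[x --> within Omega (nbhs p)] -->
    part b (boundary_value Omega f p).
  by case: b; [exact: (@holder_cvg true)|exact: (@holder_cvg false)].
by apply: cvgD; rewrite expr2; under eq_fun do rewrite expr2; exact: cvgM.
Qed.

End holder.

Section holder_norm.
Context {R : realType} {n : nat}.
Local Notation leb := (lebesgue_rV n).
Variables (Omega : set 'rV[R]_n) (omega delta N : R) (f : 'rV[R]_n -> R[i]).
Hypotheses (n0 : (0 < n)%N) (oO : open Omega) (O0 : Omega !=set0).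
Hypotheses (om0 : 0 < omega) (d0 : 0 < delta).
Hypothesis fN : (holder_norm omega delta Omega f <= N%:E)%E.

Lemma holder_seminorm_ge0 : (0 <= holder_seminorm delta Omega f)%E.
Proof.
have [x Ox] := O0; have [y Oy xy] := open_two_points (Ordinal n0) oO Ox.
apply: le_trans (ereal_sup_ubound _); last by exists x, y; split.
by rewrite lee_fin divr_ge0 ?cabs_ge0 ?powR_ge0.
Qed.

Let omN_gt0 : 0 < omega `^ (- delta). Proof. exact: powR_gt0. Qed.

Let A := ('N[leb]_+oo [EFin \o ((@cabs R \o f) \_ Omega)])%E.

Let A_le : (A <= N%:E)%E.
Proof.
apply: le_trans fN; rewrite /holder_norm leeDl//.
by rewrite mule_ge0 ?holder_seminorm_ge0// lee_fin ltW.
Qed.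

Lemma holder_norm_bound_ge0 : 0 <= N.
Proof. by rewrite -lee_fin (le_trans _ A_le)// Lnorm_ge0. Qed.

(** The weight [omega^(- delta)] of the norm makes the bound depend on [omega * edist x y] alone;
    this is the source of [eps^delta]. *)
Lemma holder_norm_dist x y : Omega x -> Omega y ->
  cabs (f x - f y) <= N * (omega * edist x y) `^ delta.
Proof.
move=> Ox Oy; have [->|xy] := eqVneq x y.
  rewrite subrr (_ : cabs 0 = 0).
    by rewrite mulr_ge0 ?holder_norm_bound_ge0 ?powR_ge0.
  by rewrite /cabs normr0.
have exy := euclidean_gt0 xy.
have : ((omega `^ (- delta))%:E * (cabs (f x - f y) / edist x y `^ delta)%:E <= N%:E)%E.
  apply: le_trans fN; rewrite /holder_norm.
  apply: (@le_trans _ _ ((omega `^ (- delta))%:E * holder_seminorm delta Omega f)%E).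
    rewrite lee_pmul2l//; apply: ereal_sup_ubound; by exists x, y; split.
  by rewrite leeDr// Lnorm_ge0.
rewrite -EFinM lee_fin powRN mulrCA -invfM ler_pdivrMr ?mulr_gt0 ?powR_gt0//.
by rewrite -powRM ?euclidean_ge0 ?(ltW om0).
Qed.

Lemma holder_norm_dist_norm x y : Omega x -> Omega y ->
  cabs (f x - f y) <= (N * (omega * n%:R) `^ delta) * `|x - y| `^ delta.
Proof.
move=> Ox Oy; rewrite (le_trans (holder_norm_dist Ox Oy))// -mulrA.
have on0 : 0 <= omega * n%:R by rewrite mulr_ge0 ?(ltW om0).
rewrite ler_wpM2l ?holder_norm_bound_ge0// -powRM//.
apply: ge0_ler_powR; rewrite ?nnegrE ?(ltW d0)//.
- by rewrite mulr_ge0 ?euclidean_ge0 ?(ltW om0).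
- by rewrite mulr_ge0.
- by rewrite -mulrA ler_wpM2l ?(ltW om0)// edist_le_norm.
Qed.

(** If the bound failed at [x], it would fail on a nonempty open set by continuity, and such a set
    is not null. *)
Lemma holder_norm_sup x : Omega x -> cabs (f x) <= N.
Proof.
move=> Ox; rewrite leNgt; apply/negP => Nx.
(* The definition of the norm of exponent [+oo] branches on this: it is the essential supremum only
   for a nonzero measure. *)
have muT : (0 < leb [set: 'rV[R]_n])%E.
  apply: (@lt_le_trans _ _ (leb Omega)); first exact: lebesgue_rV_open_gt0.
  by apply: le_measure => //; rewrite inE//; exact: measurable_open_rV.
move: A_le; rewrite /A unlock muT => /ess_supP[Z [mZ Z0 subZ]].
have K0 : 0 <= N * (omega * n%:R) `^ delta.
  by rewrite mulr_ge0 ?powR_ge0 ?holder_norm_bound_ge0.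
have e0 : 0 < cabs (f x) - N by rewrite subr_gt0.
have nx := holder_near d0 K0 holder_norm_dist_norm e0 Ox oO.
have subU : [set y | Omega y /\ cabs (f x - f y) < cabs (f x) - N]^° `<=` Z.
  move=> y /interior_subset[Oy fxy]; apply: subZ => /=.
  rewrite patchE mem_set//= lee_fin ger0_norm ?cabs_ge0//; apply/negP.
  rewrite -ltNge; have := cabsD (f x - f y) (f y); rewrite subrK; lra.
have : (0 < leb Z)%E.
  apply: (lt_le_trans (lebesgue_rV_open_gt0 (@open_interior _ _) _)); last first.
    apply: le_measure subU; rewrite inE//.
    by apply: measurable_open_rV; exact: open_interior.
  by exists x.
by rewrite Z0 ltxx.
Qed.

End holder_norm.

(** * The estimate *)

Section interior_estimate.
Context {R : realType} {n : nat}.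
Local Notation leb := (lebesgue_rV n).

Lemma weighted_mean_zero (Omega : set 'rV[R]_n) (g c : 'rV[R]_n -> R) (K : R)
    (y : 'rV[R]_n) :
  open Omega -> bounded_set Omega -> Omega y ->
  leb.-integrable Omega (EFin \o (fun x => g x * c x)) ->
  \int[leb]_(x in Omega) (g x * c x) = 0 ->
  (forall x, Omega x -> 2^-1 < c x) ->
  (forall x, Omega x -> `|g x - g y| <= K) -> `|g y| <= K.
Proof.
move=> oO bO Oy igc gc0 c2 gK; rewrite leNgt; apply/negP => Kg.
have mO := measurable_open_rV oO.
have Ooo := lebesgue_rV_bounded_lty mO bO.
have Opos : 0 < fine (leb Omega).
  by apply: fine_gt0; rewrite Ooo andbT lebesgue_rV_open_gt0//; exists y.
(* [s * g] is at least [|g y| - K > 0] on Omega and [c] exceeds 1/2, so [q] bounds [s * g * c] from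
   below. *)
pose s := Num.sg (g y); pose q := (`|g y| - K) / 2.
have q0 : 0 < q by rewrite divr_gt0// subr_gt0.
have sle x : Omega x -> q <= s * (g x * c x).
  move=> Ox; have sg : `|g y| - K <= s * g x.
    have -> : s * g x = `|g y| - s * (g y - g x).
      by rewrite mulrBr -[s * g y]normrEsg; ring.
    rewrite lerD2l lerN2 (le_trans (ler_norm _))// normrM distrC.
    rewrite (le_trans _ (gK x Ox))// ler_piMl// /s normr_sg.
    by case: (_ != 0).
  rewrite mulrA /q; apply: ler_pM => //.
  - by rewrite subr_ge0 ltW.
  - by rewrite ltW ?c2.
have iq : leb.-integrable Omega (EFin \o (fun=> q)).
  exact: (@integrable_bounded _ _ _ _ _ _ `|q|).
have : \int[leb]_(x in Omega) q <= \int[leb]_(x in Omega) (s * (g x * c x)).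
  by apply: le_Rintegral sle => //; exact: (integrableZl mO s igc).
rewrite (RintegralZl s mO igc) gc0 mulr0 Rintegral_cst//.
by apply/negP; rewrite -ltNge mulr_gt0.
Qed.

Lemma transmission_interior_bound (lam mu omega delta N r0 : R)
    (Omega : set 'rV[R]_n) (V : 'rV[R]_n -> R[i])
    (w v : 'rV[R]_n -> 'rV[R[i]]_n) (i : 'I_n) (y : 'rV[R]_n) :
  n = 2%N \/ n = 3%N -> 0 < mu -> 0 < omega -> 0 < delta ->
  open Omega -> bounded_set Omega ->
  transmission_eigenfunctions lam mu Omega V omega w v ->
  (holder_norm omega delta Omega V <= N%:E)%E ->
  (holder_norm omega delta Omega (Defs.coord w i) <= 1%:E)%E ->
  (forall t, `|t| < r0 -> 2^-1 < cos t) ->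
  omega / Num.sqrt mu * ediam Omega < r0 ->
  Omega y ->
  cabs (V y * w y ord0 i) <= 4 * (N * (ediam Omega * omega) `^ delta).
Proof.
move=> n23 mu0 om0 d0 oO bO TE VN wN cosr kr Oy.
have n0 : (0 < n)%N by case: n23 => ->.
have O0 : Omega !=set0 by exists y.
have [j ij] : exists j : 'I_n, i != j.
  have n2 : (1 < n)%N by case: n23 => ->.
  have [i0|i0] := eqVneq i (Ordinal n0); last by exists (Ordinal n0).
  by exists (Ordinal n2); rewrite i0.
have N0 := holder_norm_bound_ge0 n0 oO O0 om0 VN.
have mO := measurable_open_rV oO.
have Ooo := lebesgue_rV_bounded_lty mO bO.
set k := omega / Num.sqrt mu in kr.
have k0 : 0 < k by rewrite divr_gt0// sqrtr_gt0.
have eps0 : 0 <= ediam Omega * omega by rewrite mulr_ge0 ?ediam_ge0 ?(ltW om0).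
set E := (_ `^ delta).
have E0 : 0 <= E by exact: powR_ge0.
have dist N' g : (holder_norm omega delta Omega g <= N'%:E)%E ->
    forall x z, Omega x -> Omega z -> cabs (g x - g z) <= N' * E.
  move=> gN x z Ox Oz; rewrite (le_trans (holder_norm_dist n0 oO O0 om0 gN Ox Oz))//.
  rewrite ler_wpM2l ?(holder_norm_bound_ge0 n0 oO O0 om0 gN)//.
  apply: ge0_ler_powR; rewrite ?nnegrE ?(ltW d0)//.
    by rewrite mulr_ge0 ?euclidean_ge0 ?(ltW om0).
  by rewrite mulrC ler_wpM2r ?(ltW om0)// edist_le_ediam.
have supV := holder_norm_sup n0 oO O0 om0 d0 VN.
have supw := holder_norm_sup n0 oO O0 om0 d0 wN.
(* Product rule: [V] is bounded by [N] and varies by [N * E], while [w_i] is bounded by 1 and varies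
   by [E]. *)
have distVw x z : Omega x -> Omega z ->
    cabs (V x * w x ord0 i - V z * w z ord0 i) <= 2 * (N * E).
  move=> Ox Oz.
  have -> : V x * w x ord0 i - V z * w z ord0 i =
     V x * (w x ord0 i - w z ord0 i) + (V x - V z) * w z ord0 i by ring.
  rewrite (le_trans (cabsD _ _))// !cabsM mulr2n mulrDl mul1r; apply: lerD.
    apply: ler_pM; rewrite ?cabs_ge0 ?supV//.
    by have := dist _ _ wN x z Ox Oz; rewrite mul1r.
  rewrite -[leRHS]mulr1; apply: ler_pM; rewrite ?cabs_ge0 ?dist//.
  exact: supw.
have KN f N' (gN : (holder_norm omega delta Omega f <= N'%:E)%E) b :
    measurable_fun Omega (fun x => part b (f x)).
  apply: (holder_measurable (K := N' * (omega * n%:R) `^ delta) d0) => //.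
    by rewrite mulr_ge0 ?powR_ge0 ?(holder_norm_bound_ge0 n0 oO O0 om0 gN).
  exact: (holder_norm_dist_norm n0 oO O0 om0 d0 gN).
have mVw b : measurable_fun Omega (fun x => part b (V x * w x ord0 i)).
  have H1 := KN _ _ VN; have H2 := KN _ _ wN.
  have ReIm (x z : R[i]) : part b (x * z) =
      if b then part false x * part true z + part true x * part false z
      else part false x * part false z - part true x * part true z.
    by case: b x z => -[? ?] [? ?].
  under eq_fun do rewrite ReIm.
  by case: b {ReIm}; [apply: measurable_funD|apply: measurable_funB];
    apply: measurable_funM; (exact: H1 || exact: H2).
have iVw b : leb.-integrable Omega (EFin \o (fun x => part b (V x * w x ord0 i))).
  apply: (@integrable_bounded _ _ _ _ _ _ (N * 1)) => // x Ox.
  rewrite (le_trans (part_cabs _ _))// cabsM ler_pM ?cabs_ge0 ?supV//.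
  exact: supw.
have NE0 : 0 <= 2 * (N * E) by rewrite !mulr_ge0.
rewrite (_ : 4 * (N * E) = 2 * (2 * (N * E))); last by ring.
apply: cabs_le => // b.
(* Centred at [y], the phase is at most [k * ediam Omega < r0] on all of Omega. *)
pose c (x : 'rV[R]_n) := cos (k * (x ord0 j - y ord0 j)).
apply: (weighted_mean_zero (g := fun x => part b (V x * w x ord0 i)) (c := c) oO bO Oy).
- apply: (integrable_boundedM (M := 1) mO (iVw b)); last by move=> x _; exact: cos_max.
  apply: measurable_funS (continuous_measurable_rV _) => //.
  apply: (@continuous_comp_coord _ _ (fun t => cos (k * (t - y ord0 j)))).
  by apply: is_derive_continuous => t; exact: is_derive_cos_affine.
- exact: transmission_orthogonality TE (iVw b).
- move=> x Ox; apply: cosr; rewrite normrM gtr0_norm//.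
  apply: le_lt_trans kr; rewrite ler_pM2l//.
  by rewrite (le_trans (ler_coord_edist _ _ _))// edist_le_ediam.
- by move=> x Ox; rewrite -partN -partD (le_trans (part_cabs _ _))// distVw.
Qed.

End interior_estimate.

(** Continuity at 0 is enough, since [r] enters only the final constant. *)
Lemma cos_gt_half_near0 (R : realType) :
  exists2 r : R, 0 < r & forall t : R, `|t| < r -> 2^-1 < cos t.
Proof.
have half : (0 : R) < 2^-1 by [].
have /cvgrPdist_lt/(_ _ half) := @continuous_cos R 0.
move=> /nbhs_ballP[r /= r0 H]; exists r => // t tr.
have := H t; rewrite /ball/= sub0r normrN => /(_ tr).
rewrite cos0 => /ltr_normlW; lra.
Qed.

(** The lower bound is uniform in [delta], which keeps the final constant independent of [delta]. *)
Lemma powR_ge_min (R : realType) (e0 e delta : R) : 0 < e0 -> e0 <= 1 ->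
  e0 <= e -> 0 < delta -> delta <= 1 -> e0 <= e `^ delta.
Proof.
move=> p0 p1 pe d0 d1; apply: (@le_trans _ _ (e0 `^ delta)).
  rewrite -[leLHS]powRr1 ?(ltW p0)//; apply: ger_powR => //.
  by rewrite p0.
by apply: ge0_ler_powR; rewrite ?nnegrE ?(ltW d0) ?(ltW p0) ?(le_trans (ltW p0)).
Qed.

Theorem theorem4p5 (R : realType) (n : nat) (lam mu : R)
    (hn : n = 2%N \/ n = 3%N) (hmu : 0 < mu) (hlam : 0 < n%:R * lam + 2 * mu) :
  exists2 C : R, 0 < C &
  forall (D : R) (Omega : set 'rV[R]_n) (V : 'rV[R]_n -> R[i])
         (omega delta : R) (w v : 'rV[R]_n -> 'rV[R[i]]_n),
  0 < D -> ediam Omega <= D ->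
  inhomogeneous_medium_scatterer lam mu Omega V ->
  0 < omega ->
  0 < delta -> (n = 2%N -> delta <= 1) -> (n = 3%N -> delta <= 1 / 2) ->
  (holder_norm omega delta Omega V < +oo)%E ->
  0 < inf [set cabs (boundary_value Omega V p) | p in bdry Omega] ->
  transmission_eigenfunctions lam mu Omega V omega w v ->
  (vholder_norm omega delta Omega w <= 1)%E ->
  let eps := ediam Omega * omega in
  (ereal_sup [set (vabs (vboundary_value Omega w p))%:E | p in bdry Omega] <=
   (C * (fine (holder_norm omega delta Omega V) /
         inf [set cabs (boundary_value Omega V p) | p in bdry Omega])
      * eps `^ delta * (1 + (1 + eps) * eps `^ (n%:R / 2)))%:E)%E.
Proof.
have [r0 r00 cosr] := cos_gt_half_near0 R.
(* When the phase bound fails, [eps >= r0 * Num.sqrt mu]; the cap at 1 is for [powR_ge_min]. In [C1]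
   below, 4 serves small [eps] and the inverse of [e1] the rest. *)
pose e1 := Num.min 1 (r0 * Num.sqrt mu).
have smu0 : 0 < Num.sqrt mu by rewrite sqrtr_gt0.
have e10 : 0 < e1 by rewrite /e1 lt_min ltr01 mulr_gt0.
pose C1 := 4 + e1^-1.
have C10 : 0 < C1 by rewrite addr_gt0// invr_gt0.
exists (n%:R * C1); first by rewrite mulr_gt0//; case: hn => ->; rewrite ltr0n.
move=> D Omega V omega delta w v _ _ [[neO oO _ bO _] _ _ _ _] om0 d0 dn2 dn3.
move=> Voo inf0 TE wle; cbv zeta; set eps := ediam Omega * omega.
have n0 : (0 < n)%N by case: hn => ->.
have d1 : delta <= 1.
  case: hn => nE; first exact: dn2.
  by rewrite (le_trans (dn3 nE))// ler_pdivrMr// mul1r ler1n.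
set I := inf _ in inf0 *.
set N := fine _.
have VN : (holder_norm omega delta Omega V <= N%:E)%E.
  rewrite fineK// ge0_fin_numE//.
  by rewrite adde_ge0 ?Lnorm_ge0// mule_ge0 ?lee_fin ?powR_ge0 ?holder_seminorm_ge0.
have wN i : (holder_norm omega delta Omega (Defs.coord w i) <= 1%:E)%E.
  by apply: le_trans wle; rewrite /vholder_norm; exact: (le_bigmax _ _ i).
have N0 := holder_norm_bound_ge0 n0 oO neO om0 VN.
have eps0 : 0 <= eps by rewrite mulr_ge0 ?ediam_ge0 ?(ltW om0).
have Q0 : 0 <= (1 + eps) * eps `^ (n%:R / 2).
  by rewrite mulr_ge0 ?powR_ge0 ?addr_ge0.
have NI0 : 0 <= N / I by rewrite divr_ge0 ?(ltW inf0).
apply: ge_ereal_sup => _ [p bp <-]; rewrite lee_fin.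
have [cp _] := bp.
have PF : ProperFilter (within Omega (nbhs p)) by exact: within_nbhs_proper.
have bcvg f N' : (holder_norm omega delta Omega f <= N'%:E)%E ->
    cabs (f x) @[x --> within Omega (nbhs p)] --> cabs (boundary_value Omega f p).
  move=> fN; apply: (holder_boundary (K := N' * (omega * n%:R) `^ delta) d0) => //.
    by rewrite mulr_ge0 ?powR_ge0 ?(holder_norm_bound_ge0 n0 oO neO om0 fN).
  exact: (holder_norm_dist_norm n0 oO neO om0 d0 fN).
have lim_le (f : 'rV[R]_n -> R) (l M : R) : f x @[x --> within Omega (nbhs p)] --> l ->
    (forall x, Omega x -> f x <= M) -> l <= M.
  move=> fl fM; apply: (ler_cvg_to fl (cvg_cst M)).
  by apply: filterS (withinT _ _) => x; exact: fM.
set bV := cabs (boundary_value Omega V p).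
have IV : I <= bV.
  apply: ge_inf; last by exists p.
  by exists 0 => _ [q _ <-]; exact: cabs_ge0.
have bV0 : 0 < bV by exact: lt_le_trans IV.
have VbN : bV <= N.
  exact: (lim_le _ _ _ (bcvg _ _ VN) (holder_norm_sup n0 oO neO om0 d0 VN)).
set X := C1 * (N / I) * eps `^ delta.
have X0 : 0 <= X by apply: mulr_ge0; [exact: mulr_ge0 (ltW C10) NI0|exact: powR_ge0].
(* Passing from components to [vabs] costs the factor [n], and the last factor of the claim is at
   least 1. *)
suff comp i : cabs (boundary_value Omega (Defs.coord w i) p) <= X.
  apply: (@le_trans _ _ (n%:R * X)).
    rewrite /vabs; apply: sqrt_sum_le => // i.
    by rewrite ger0_norm ?cabs_ge0// mxE.
  rewrite /X !mulrA -[leLHS]mulr1 ler_wpM2l ?lerDl//.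
  by rewrite !mulr_ge0 ?invr_ge0 ?powR_ge0 ?(ltW C10) ?(ltW inf0).
set bw := cabs _.
have bw1 : bw <= 1.
  exact: (lim_le _ _ _ (bcvg _ _ (wN i)) (holder_norm_sup n0 oO neO om0 d0 (wN i))).
have bw0 : 0 <= bw by exact: cabs_ge0.
have e1inv0 : 0 <= e1^-1 by rewrite invr_ge0 ltW.
have [kr|kr] := ltP (omega / Num.sqrt mu * ediam Omega) r0.
- have H : bV * bw <= 4 * (N * eps `^ delta).
    apply: (lim_le _ _ _ (cvgM (bcvg _ _ VN) (bcvg _ _ (wN i)))) => x Ox.
    rewrite -[leLHS]cabsM.
    exact: (transmission_interior_bound hn hmu om0 d0 oO bO TE VN (wN i) cosr kr).
  apply: (@le_trans _ _ (4 * (N / I) * eps `^ delta)); last first.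
    by rewrite /X -!mulrA ler_wpM2r ?mulr_ge0 ?powR_ge0 ?invr_ge0 ?(ltW inf0)// lerDl.
  rewrite (_ : 4 * (N / I) * eps `^ delta = (4 * (N * eps `^ delta)) / I); last by ring.
  (* [I <= bV] replaces the value of [V] at [p] by the infimum. *)
  by rewrite ler_pdivlMr// mulrC (le_trans _ H)// ler_wpM2r.
- have e1eps : e1 <= eps.
    have kE : omega / Num.sqrt mu * ediam Omega = eps / Num.sqrt mu.
      by rewrite /eps; ring.
    by move: kr; rewrite kE ler_pdivlMr// => H; rewrite /e1 ge_min H orbT.
  have e11 : e1 <= 1 by rewrite /e1 ge_min lexx.
  have ed : e1 <= eps `^ delta by exact: powR_ge_min.
  rewrite (le_trans bw1)// /X.
  have h1 : 1 <= N / I by rewrite ler_pdivlMr// mul1r (le_trans IV).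
  (* Since [C1] is at least the inverse of [e1] and [eps^delta] is at least [e1]. *)
  have h2 : 1 <= C1 * eps `^ delta.
    rewrite -(mulVf (lt0r_neq0 e10)); apply: ler_pM => //; first exact: ltW.
    by rewrite /C1 lerDr.
  rewrite mulrAC -[leLHS]mulr1; apply: ler_pM => //.
Qed.
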